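(* Let $M$ be a nonempty manifold of dimension $\geq3$. Then the set $\{g\in\mathrm{Metr}(M): Y_M(g)=-\infty\}$ is open and closed with respect to the fine $C^2$-topology on $\mathrm{Metr}(M)$.
   Context: Conventions: manifolds are smooth, pure-dimensional, second countable, without boundary, and not necessarily connected. $\mathrm{Metr}(M)$ is the set of smooth Riemannian metrics on $M$. Yamabe constant: for a nonempty $n$-manifold $M$ with $n\geq3$, put $p=\frac{2n}{n-2}$ and $a_n=\frac{4(n-1)}{n-2}$. For $g\in\mathrm{Metr}(M)$ and $v\in C^\infty_c(M,\mathbb{R}_{\geq0})\setminus\{0\}$ let $$E_g(v)=\frac{1}{\|v\|_{L^p(g)}^2}\int_M\big(a_n|dv|_g^2+\mathrm{scal}_g\,v^2\big)\,d\mu_g,$$ where $\mathrm{scal}_g$ is the scalar curvature and $d\mu_g$ the Riemannian density of $g$. The Yamabe constant of $g$ is $Y_M(g)=\inf\{E_g(v) : v\in C_c^\infty(M,\mathbb{R}_{\geq0})\setminus\{0\}\}\in\mathbb{R}\cup\{-\infty\}$. Fine (strong, Whitney) $C^2$-topology on $\mathrm{Metr}(M)$: let $J^2\mathrm{Sym}^2_+T^*M$ be the 2-jet bundle of the bundle of positive definite symmetric bilinear forms on the tangent spaces of $M$, and for a metric $h$ let $\mathrm{graph}(j^2h)$ be the image of its 2-jet prolongation in the total space. A neighborhood basis at $g$ is given by the sets $\{h\in\mathrm{Metr}(M): \mathrm{graph}(j^2h)\subseteq U\}$, where $U$ ranges over the open neighborhoods of $\mathrm{graph}(j^2g)$ in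 the total space of $J^2\mathrm{Sym}^2_+T^*M$. *)

(* Defs.v *)
From HB Require Import structures.
From mathcomp Require Import all_boot all_order all_algebra.
From mathcomp Require Import all_classical all_reals all_analysis.
From mathcomp Require Import perm measurable_realfun lra.

Set Implicit Arguments.
Unset Strict Implicit.
Unset Printing Implicit Defensive.

Import Order.TTheory GRing.Theory Num.Theory.
Import numFieldNormedType.Exports.

Local Open Scope classical_set_scope.
Local Open Scope ring_scope.

Section smooth_functions.
Context {R : realType} {n : nat}.
Implicit Types (W : set 'rV[R]_n) (f : 'rV[R]_n -> R) (x : 'rV[R]_n).

Definition partial (a : 'I_n) f : 'rV[R]_n -> R :=
  fun x => 'D_(delta_mx 0 a) f x.

(* Only meaningful for W open. *)
Fixpoint Ck (k : nat) W f : Prop :=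
  {within W, continuous f} /\
  (if k is k'.+1 then
     forall a : 'I_n, (forall x, W x -> derivable f x (delta_mx 0 a)) /\
                      Ck k' W (partial a f)
   else True).

Definition smooth_on W f : Prop := forall k, Ck k W f.

End smooth_functions.

Section chart.
Context (R : realType) (n : nat) (T : topologicalType).

(* A homeomorphism cmap from the open set cdom onto an open set of R^n, with
   inverse cinv; the values of cmap off cdom and of cinv off cmap @` cdom are
   irrelevant. *)
Record chart := Chart {
  cdom : set T ;
  cmap : T -> 'rV[R]_n ;
  cinv : 'rV[R]_n -> T ;
  open_cdom : open cdom ;
  open_cimg : open (cmap @` cdom) ;
  cmapK : forall p, cdom p -> cinv (cmap p) = p ;
  cmap_continuous : {within cdom, continuous cmap} ;
  cinv_continuous : {within cmap @` cdom, continuous cinv} }.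

End chart.

(* Nonempty smooth n-manifolds without boundary, given by an atlas (not
   necessarily maximal).  The base point of the carrier only expresses
   nonemptiness. *)
Record smooth_manifold (R : realType) (n : nat) := SmoothManifold {
  carrier :> ptopologicalType ;
  carrier_hausdorff : hausdorff_space carrier ;
  carrier_second_countable : @second_countable carrier ;
  cidx : Type ;
  charts : cidx -> chart R n carrier ;
  charts_cover : forall p : carrier, exists i, cdom (charts i) p ;
  charts_compatible : forall i j (c : 'I_n),
    smooth_on (cmap (charts i) @` (cdom (charts i) `&` cdom (charts j)))
              (fun x => cmap (charts j) (cinv (charts i) x) 0 c) }.

Section manifold.
Context {R : realType} {n : nat} (M : smooth_manifold R n).
Implicit Types (i j : cidx M) (p : M).

Definition dom i : set M := cdom (charts i).
Definition crd i : M -> 'rV[R]_n := cmap (charts i).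
Definition par i : 'rV[R]_n -> M := cinv (charts i).

Definition smooth (v : M -> R) : Prop :=
  forall i, smooth_on (crd i @` dom i) (v \o par i).

(* transition_jac i j x a c is the derivative with respect to the a-th
   coordinate of chart i of the c-th coordinate of chart j. *)
Definition transition_jac i j (x : 'rV[R]_n) : 'M[R]_n :=
  \matrix_(a, c) partial a (fun y => crd j (par i y) 0 c) x.

End manifold.

Section metrics.
Context {R : realType} {n : nat} (M : smooth_manifold R n).
Implicit Types (i j : cidx M) (p : M) (W : set M).

(* A field of bilinear forms on tangent spaces is given by its components:
   g i p a b is the value at p on the a-th and b-th coordinate vectors of the
   chart i.  The normalization metric_out makes the components of a given
   Riemannian metric on W unique. *)
Record metric_on W (g : cidx M -> M -> 'M[R]_n) : Prop := MetricOn {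
  metric_out : forall i p, ~ (W `&` dom i) p -> g i p = 0 ;
  metric_sym : forall i p, (W `&` dom i) p -> (g i p)^T = g i p ;
  metric_pos : forall i p, (W `&` dom i) p ->
    forall u : 'rV[R]_n, u != 0 -> 0 < (u *m g i p *m u^T) 0 0 ;
  metric_smooth : forall i a b,
    smooth_on (crd i @` (W `&` dom i)) (fun x => g i (par i x) a b) ;
  metric_change : forall i j p, (W `&` dom i `&` dom j) p ->
    g i p = transition_jac i j (crd i p) *m g j p *m
            (transition_jac i j (crd i p))^T }.

Record metric := Metric {
  metric_val :> cidx M -> M -> 'M[R]_n ;
  metricP : metric_on setT metric_val }.

Record local_metric := LocalMetric {
  lm_dom : set M ;
  lm_val :> cidx M -> M -> 'M[R]_n ;
  open_lm_dom : open lm_dom ;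
  local_metricP : metric_on lm_dom lm_val }.

Definition local_of_metric (g : metric) : local_metric :=
  LocalMetric openT (metricP g).

End metrics.

Section jets.
Context {R : realType} {n : nat} (M : smooth_manifold R n).
Implicit Types (i : cidx M) (p : M).

(* Values are: the coordinates of p, the components of g, their first and their
   second partial derivatives. *)
Definition jet_model : Type :=
  ('rV[R]_n * 'M[R]_n * 'rV['M[R]_n]_n * 'M['M[R]_n]_n)%type.

Definition jet_crd i (g : local_metric M) p : jet_model :=
  let G (c d : 'I_n) := fun x => g i (par i x) c d in
  let x := crd i p in
  (x, g i p,
   \row_a \matrix_(c, d) partial a (G c d) x,
   \matrix_(a, b) \matrix_(c, d) partial a (partial b (G c d)) x).

Definition same_2jet p (g h : local_metric M) : Prop :=
  forall i, dom i p -> jet_crd i g p = jet_crd i h p.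

Definition jet_class p (g : local_metric M) : set (local_metric M) :=
  [set h | lm_dom h p /\ same_2jet p g h].

(* The total space of the bundle of 2-jets of local sections of Sym^2_+ T^*M. *)
Record jet2 := Jet2 {
  jet_pt : M ;
  jet_cls : set (local_metric M) ;
  jet_clsP : exists2 g, lm_dom g jet_pt & jet_cls = jet_class jet_pt g }.

Definition jet_rep (J : jet2) : local_metric M :=
  projT1 (cid2 (jet_clsP J)).

Definition jet2_crd i (J : jet2) : jet_model :=
  jet_crd i (jet_rep J) (jet_pt J).

Definition jet2_dom i : set jet2 := [set J | dom i (jet_pt J)].

HB.instance Definition _ := gen_eqMixin jet2.
HB.instance Definition _ := gen_choiceMixin jet2.

(* The maps jet2_crd i : jet2_dom i -> jet_model are the bundle charts; they
   are injective, and the topology is the one that they generate. *)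
Definition jet2_subbase : set (set jet2) :=
  [set V | exists i (A : set jet_model), open A /\
                                         V = jet2_dom i `&` jet2_crd i @^-1` A].

HB.instance Definition _ := isSubBaseTopological.Build jet2 jet2_subbase id.

Lemma j2_subproof (g : metric M) p :
  exists2 h, lm_dom h p & jet_class p (local_of_metric g) = jet_class p h.
Proof. by exists (local_of_metric g). Qed.

Definition j2 (g : metric M) p : jet2 := Jet2 (j2_subproof g p).

Definition graph_j2 (g : metric M) : set jet2 := range (j2 g).

(* Metr(M) endowed with the fine C^2-topology. *)
Definition fine_C2 : Type := metric M.

HB.instance Definition _ := gen_eqMixin fine_C2.
HB.instance Definition _ := gen_choiceMixin fine_C2.

Definition fine_C2_open (S : set fine_C2) : Prop :=
  forall g, S g -> exists U : set jet2,
    [/\ open U, graph_j2 g `<=` U &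
        [set h : fine_C2 | graph_j2 h `<=` U] `<=` S].

Lemma fine_C2_openT : fine_C2_open setT.
Proof. by move=> g _; exists setT; split=> //; exact: openT. Qed.

Lemma fine_C2_openI : setI_closed fine_C2_open.
Proof.
move=> S T oS oT g [Sg Tg].
have [U [oU gU US]] := oS g Sg; have [V [oV gV VT]] := oT g Tg.
exists (U `&` V); split; [exact: openI|by rewrite subsetI; split|].
by move=> h /=; rewrite subsetI => -[hU hV]; split; [exact: US|exact: VT].
Qed.

Lemma fine_C2_open_bigU (I : Type) (f : I -> set fine_C2) :
  (forall k, fine_C2_open (f k)) -> fine_C2_open (\bigcup_k f k).
Proof.
move=> of_ g [k _ fkg]; have [U [oU gU Uf]] := of_ k g fkg.
by exists U; split=> // h hU; exists k => //; exact: Uf.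
Qed.

HB.instance Definition _ := isOpenTopological.Build fine_C2
  fine_C2_openT fine_C2_openI fine_C2_open_bigU.

End jets.

Section lebesgue_measure_Rn.
Context {R : realType}.

Local Notation Rn n := (n.-tuple (measurableTypeR R)).

Definition tcons n (xt : measurableTypeR R * Rn n) : Rn n.+1 :=
  [tuple of xt.1 :: xt.2].

Lemma measurable_tcons n : measurable_fun setT (@tcons n).
Proof. exact: measurable_cons. Qed.

Lemma tcons_preimage n (A : set (Rn n.+1)) :
  measurable A -> measurable (@tcons n @^-1` A).
Proof. by rewrite -[X in _ -> measurable X]setTI; exact: measurable_tcons. Qed.

Definition lebesgue_cons n
    (mu : {sigma_finite_measure set (Rn n) -> \bar R}) :
    set (Rn n.+1) -> \bar R :=
  pushforward (@lebesgue_measure R \x mu)%E (@tcons n).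

Section instances.
Local Open Scope ereal_scope.
Variables (n : nat) (mu : {sigma_finite_measure set (Rn n) -> \bar R}).

Let lebesgue_cons0 : lebesgue_cons mu set0 = 0.
Proof. by rewrite /lebesgue_cons /pushforward preimage_set0 measure0. Qed.

Let lebesgue_cons_ge0 A : 0 <= lebesgue_cons mu A.
Proof. by rewrite /lebesgue_cons /pushforward; exact: measure_ge0. Qed.

Let lebesgue_cons_sigma_additive : semi_sigma_additive (lebesgue_cons mu).
Proof.
move=> F mF tF mUF; rewrite /lebesgue_cons /pushforward preimage_bigcup.
apply: measure_semi_sigma_additive.
- by move=> k; exact: tcons_preimage.
- apply/trivIsetP => /= i j _ _ ij; rewrite -preimage_setI.
  by move/trivIsetP : tF => /(_ _ _ _ _ ij) ->//; rewrite preimage_set0.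
- by rewrite -preimage_bigcup; exact: tcons_preimage.
Qed.

HB.instance Definition _ := isMeasure.Build _ _ _ (lebesgue_cons mu)
  lebesgue_cons0 lebesgue_cons_ge0 lebesgue_cons_sigma_additive.

Let lebesgue_cons_sigma_finite : sigma_finite setT (lebesgue_cons mu).
Proof.
have /sigma_finiteP[F [TF ndF Foo]] := sigma_finiteT (@lebesgue_measure R).
have /sigma_finiteP[G [TG ndG Goo]] := sigma_finiteT mu.
pose u (t : Rn n.+1) : measurableTypeR R * Rn n :=
  (tnth t ord0, [tuple of behead t]).
have mu_ : measurable_fun setT u.
  apply: measurable_fun_pair; first exact: (measurable_tnth ord0).
  exact: (@measurable_behead _ (measurableTypeR R) n).
have tconsK : cancel (@tcons n) u.
  by move=> [x t]; rewrite /u /tcons; congr pair; apply: val_inj.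
exists (fun k => u @^-1` (F k `*` G k)).
  rewrite -preimage_bigcup (_ : \bigcup_k _ = setT) ?preimage_setT//.
  rewrite -setXTT TF TG predeqE => -[x y]; split.
    by move=> [k _ []/= ? ?]; split; exists k.
  move=> [/= [k _ Fkx] [l _ Gly]]; exists (maxn k l) => //; split.
  - by move: x Fkx; exact/subsetPset/ndF/leq_maxl.
  - by move: y Gly; exact/subsetPset/ndG/leq_maxr.
move=> k; have [mF lF] := Foo k; have [mG lG] := Goo k; split.
  by rewrite -[X in measurable X]setTI; apply: mu_ => //; exact: measurableX.
rewrite /lebesgue_cons /pushforward -comp_preimage (_ : u \o @tcons n = id).
  rewrite preimage_id.
  by rewrite product_measure1E// lte_mul_pinfty// ge0_fin_numE.
by apply/funext => x /=; rewrite tconsK.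
Qed.

HB.instance Definition _ := Measure_isSigmaFinite.Build _ _ _
  (lebesgue_cons mu) lebesgue_cons_sigma_finite.

End instances.

Fixpoint lebesgue_Rn n : {sigma_finite_measure set (Rn n) -> \bar R} :=
  match n with
  | 0 => dirac ([tuple] : Rn 0)
  | n'.+1 => lebesgue_cons (lebesgue_Rn n')
  end.

Definition row_of_tuple n (t : Rn n) : 'rV[R]_n := \row_i tnth t i.

Lemma measurable_row_of_tuple n (O : set 'rV[R]_n) :
  open O -> measurable (@row_of_tuple n @^-1` O).
Proof.
move=> oO.
pose box (q : 'rV[rat]_n * rat) : set (Rn n) :=
  [set t | forall i : 'I_n, `|tnth t i - ratr (q.1 0 i)| < ratr q.2].
pose rbox (q : 'rV[rat]_n * rat) : set 'rV[R]_n :=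
  [set x | forall i : 'I_n, `|x 0 i - ratr (q.1 0 i)| < ratr q.2].
have mbox q : measurable (box q).
  rewrite (_ : box q = \bigcap_(i in [set: 'I_n])
      ((fun t : Rn n => tnth t i) @^-1`
        `]ratr (q.1 0 i) - ratr q.2, ratr (q.1 0 i) + ratr q.2[)).
    apply: fin_bigcap_measurable => [|i _]; first exact: finite_finset.
    rewrite -[X in measurable X]setTI.
    by apply: measurable_tnth => //; exact: measurable_itv.
  apply/seteqP; split => t /=.
    by move=> bt i _ /=; have := bt i; rewrite in_itv /= ltr_distl.
  by move=> bt i; have := bt i I; rewrite /= in_itv /= ltr_distl.
rewrite (_ : _ @^-1` _ = \bigcup_(q in [set q | rbox q `<=` O]) box q).
  by rewrite bigcup_mkcond; apply: countable_bigcupT_measurable => // q;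
    case: ifP.
apply/seteqP; split => t /=; last first.
  by move=> [q qO qt]; apply: qO => i; rewrite mxE; exact: qt.
move=> Ot; have : nbhs (row_of_tuple t) O by exact: open_nbhs_nbhs.
move=> /nbhs_ballP[e /= e0 eO].
have [r] : exists r : rat, ratr r \in `]0, e / 2[ by apply: rat_in_itvoo;
  rewrite divr_gt0.
rewrite in_itv /= => /andP[r0 re].
have qP (i : 'I_n) : exists q : rat, `|tnth t i - ratr q| < ratr r.
  have [q] : exists q : rat,
      ratr q \in `]tnth t i - ratr r, tnth t i + ratr r[.
    by apply: rat_in_itvoo; rewrite ltrD2l gtrN.
  by rewrite in_itv /= => /andP[q1 q2]; exists q; rewrite ltr_norml; lra.
have [q qt] := choice qP.
exists (\row_i q i, r) => [x /= xq|i /=]; last by rewrite mxE.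
apply: eO; split=> // i j; rewrite /ball /= ord1 mxE.
have := xq j; rewrite mxE => xqj.
rewrite (le_lt_trans (ler_distD (ratr (q j)) _ _))//.
rewrite [e]splitr ltrD//; first exact: lt_trans (qt j) re.
by rewrite distrC (lt_trans xqj).
Qed.

End lebesgue_measure_Rn.

Section cells.
Context {R : realType} {n : nat} (M : smooth_manifold R n).
Implicit Types (i : cidx M) (p : M).

(* A countable family of compact sets, each contained in a chart domain, whose
   interiors cover M. *)
Record chart_cover := ChartCover {
  cover_idx : nat -> cidx M ;
  cover_set : nat -> set M ;
  cover_compact : forall k, compact (cover_set k) ;
  cover_sub : forall k, cover_set k `<=` dom (cover_idx k) ;
  cover_interior : \bigcup_k (cover_set k)° = [set: M] }.

Lemma within_open_preimage (S T : topologicalType) (D : set S) (f : S -> T)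
    (A : set T) :
  open D -> {within D, continuous f} -> open A -> open (D `&` f @^-1` A).
Proof.
move=> oD; rewrite continuous_open_subspace// => cf oA.
rewrite openE => x [Dx Ax]; apply: filterI; first exact: open_nbhs_nbhs.
by apply: cf; [rewrite inE|exact: open_nbhs_nbhs].
Qed.

Lemma compact_nbhs_chart p :
  exists i (K : set M), [/\ compact K, K `<=` dom i & K° p].
Proof.
have [i ip] := charts_cover p.
have /nbhs_ballP[e /= e0 eD] : nbhs (crd i p) (crd i @` dom i).
  by apply: open_nbhs_nbhs; split; [exact: open_cimg|exists p].
have e2 : 0 < e / 2 by rewrite divr_gt0.
have BD : closed_ball (crd i p) (e / 2) `<=` crd i @` dom i.
  apply: subset_trans eD; apply: closed_ball_subset => //.
  by rewrite [ltRHS]splitr ltrDl.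
exists i, (par i @` closed_ball (crd i p) (e / 2)); split.
- apply: continuous_compact.
    exact: continuous_subspaceW BD (@cinv_continuous _ _ _ _).
  apply: bounded_closed_compact; last exact: closed_ball_closed.
  exists (`|crd i p| + e / 2); split; first exact: num_real.
  move=> N eN y; rewrite closed_ballE// /closed_ball_ /= => ye.
  rewrite (le_trans _ (ltW eN))// -[y in leLHS](subKr (crd i p)).
  by rewrite (le_trans (ler_normB _ _))// lerD2l.
- by move=> _ [x /BD[q iq <-] <-]; rewrite /par cmapK.
- rewrite /interior; apply: (@filterS _ _ _
    (dom i `&` crd i @^-1` ball (crd i p) (e / 2))).
    move=> q [iq xq]; exists (crd i q); last by rewrite /par cmapK.
    exact: subset_closed_ball.
  apply: open_nbhs_nbhs; split.
    apply: within_open_preimage; [exact: open_cdom|exact: cmap_continuous|].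
    exact: ball_open.
  by split => //; exact: ballxx.
Qed.

Lemma ex_chart_cover : exists c : chart_cover, True.
Proof.
have [B cB [Bo Bb]] := carrier_second_countable M.
have /pfcard_geP[B0|[b]] := cB.
  by have [U [+ _] _] := Bb point _ filterT; rewrite B0.
have [i0 _] := charts_cover (point : M).
pose good k (iK : cidx M * set M) :=
  [/\ compact iK.2, iK.2 `<=` dom iK.1 & b k `<=` iK.2°].
pose s k : cidx M * set M :=
  if pselect (exists iK, good k iK) is left P then projT1 (cid P)
  else (i0, set0).
have sP k : compact (s k).2 /\ (s k).2 `<=` dom (s k).1.
  rewrite /s; case: pselect => [P|_].
    by have [] := projT2 (cid P).
  by split=> //; exact: compact0.
apply: ex_intro I; apply: (@ChartCover (fun k => (s k).1) (fun k => (s k).2)).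
- by move=> k; have [] := sP k.
- by move=> k; have [] := sP k.
apply/seteqP; split=> // p _.
have [i [K [cK Ki Kp]]] := compact_nbhs_chart p.
have [|U [BU Up] UK] := Bb p K°; first exact: nbhs_interior.
have [k _ bk] := @surj _ _ _ _ b _ BU.
exists k => //=; rewrite /s; case: pselect => [P|[]].
  by have [_ _ +] := projT2 (cid P); apply; rewrite bk.
by exists (i, K); split=> //=; rewrite bk.
Qed.

Definition the_cover : chart_cover := projT1 (cid ex_chart_cover).

(* A partition of M into countably many sets with compact closure contained in
   a chart domain. *)
Definition cell : (set M)^nat := seqDU (cover_set the_cover).

Lemma ex_cell p : exists k, cell k p.
Proof.
have : (\bigcup_k cover_set the_cover k) p.
  have : (\bigcup_k (cover_set the_cover k)°) p by rewrite cover_interior.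
  by move=> [k _ /nbhs_singleton kp]; exists k.
by rewrite seqDU_bigcup_eq => -[k _ kp]; exists k.
Qed.

Definition chart_at p : cidx M :=
  cover_idx the_cover (projT1 (cid (ex_cell p))).

Lemma chart_atP p : dom (chart_at p) p.
Proof.
by apply: cover_sub; apply: subset_seqDU; exact: projT2 (cid (ex_cell p)).
Qed.

End cells.

Section riemannian_measure.
Context {R : realType} {n : nat} (M : smooth_manifold R n).
Implicit Types (i : cidx M).

Definition borel : measurableType (sigma_display (@open M)) :=
  g_sigma_algebraType (@open M).

Local Notation rowt := (@row_of_tuple R n).

Lemma crd_image i (A : set M) :
  crd i @` (A `&` dom i) = crd i @` dom i `&` par i @^-1` A.
Proof.
apply/seteqP; split => x /=.
  by move=> [p [Ap ip] <-]; split; [exists p|rewrite /par cmapK].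
by move=> [[p ip <-]]; rewrite /par cmapK// => Ap; exists p.
Qed.

Lemma measurable_crd_dom i : measurable (rowt @^-1` (crd i @` dom i)).
Proof. by apply: measurable_row_of_tuple; exact: open_cimg. Qed.

Lemma measurable_par i :
  measurable_fun (rowt @^-1` (crd i @` dom i))
    (fun t => par i (rowt t) : borel).
Proof.
apply: (@measurability _ _ _ borel _ _ (@open M)) => // _ [A oA <-].
apply: (measurable_row_of_tuple (O := crd i @` dom i `&` par i @^-1` A)).
by apply: within_open_preimage => //; [exact: open_cimg|exact: cinv_continuous].
Qed.

Lemma measurable_crd i (A : set borel) : measurable A ->
  measurable (rowt @^-1` (crd i @` (A `&` dom i))).
Proof.
move=> mA; rewrite crd_image preimage_setI -comp_preimage.
exact: (measurable_par (measurable_crd_dom i)).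
Qed.

Lemma measurable_cell k : measurable (cell k : set borel).
Proof.
apply: (@seqDU_measurable _ borel) => l.
rewrite -[X in measurable X]setCK; apply: measurableC.
apply: sub_sigma_algebra; apply: closed_openC.
by apply: compact_closed; [exact: carrier_hausdorff|exact: cover_compact].
Qed.

Variable g : metric M.

Definition density i (t : n.-tuple (measurableTypeR R)) : R :=
  Num.sqrt (\det (g i (par i (rowt t)))).

Definition chart_volume i (A : set borel) : \bar R :=
  (\int[lebesgue_Rn n]_(t in rowt @^-1` (crd i @` (A `&` dom i)))
    (density i t)%:E)%E.

Lemma measurable_density i :
  measurable_fun (rowt @^-1` (crd i @` dom i)) (density i).
Proof.
have ms : measurable_fun setT (@Num.sqrt R).
  by apply: continuous_measurable_fun; exact: sqrt_continuous.
apply: (measurableT_comp ms (g := fun t => \det (g i (par i (rowt t))))).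
apply: measurable_sum => s; apply: measurable_funM => //.
apply: measurable_prod => c _ /=.
have [+ _] := metric_smooth (metricP g) i c (s c) 0%N; rewrite setTI => cg.
move=> mD; apply: (measurability _ (RGenOpens.measurableE R)) => //.
move=> _ [_ [x [y ->]] <-].
apply: (measurable_row_of_tuple (O := crd i @` dom i `&`
  (fun z => g i (par i z) c (s c)) @^-1` `]x, y[)).
by apply: within_open_preimage => //; exact: open_cimg.
Qed.

Section instances.
Local Open Scope ereal_scope.
Variable i : cidx M.

Let chart_volume0 : chart_volume i set0 = 0.
Proof.
by rewrite /chart_volume set0I image_set0 preimage_set0 integral_set0.
Qed.

Let chart_volume_ge0 A : 0 <= chart_volume i A.
Proof. by apply: integral_ge0 => t _; rewrite lee_fin sqrtr_ge0. Qed.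

Let chart_volume_sigma_additive : semi_sigma_additive (chart_volume i).
Proof.
move=> F mF tF mUF; rewrite /chart_volume setI_bigcupl image_bigcup.
rewrite preimage_bigcup ge0_integral_bigcup//=.
- by apply: is_cvg_ereal_nneg_natsum_cond => // k _ _; exact: chart_volume_ge0.
- by move=> k; exact: measurable_crd.
- apply/measurable_EFinP.
  apply: (measurable_funS (measurable_crd_dom i) _ (measurable_density (i := i))).
  by move=> t [k _ [p [_ ip] pt]]; exists p.
- by move=> t _; rewrite lee_fin sqrtr_ge0.
- apply/trivIsetP => k l _ _ kl; rewrite !crd_image -preimage_setI setIACA.
  rewrite -preimage_setI; move/trivIsetP : tF => /(_ _ _ _ _ kl) -> //.
  by rewrite preimage_set0 setI0.
Qed.

HB.instance Definition _ := isMeasure.Build _ _ _ (chart_volume i)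
  chart_volume0 chart_volume_ge0 chart_volume_sigma_additive.

End instances.

(* The Riemannian density: the sum over k of the restrictions of
   chart_volume (cover_idx the_cover k) to cell k.  By the change of variables
   formula it does not depend on the choice of the_cover. *)
Definition riemannian_measure : {measure set borel -> \bar R} :=
  mseries (fun k => mrestr (chart_volume (cover_idx (the_cover M) k))
                           (measurable_cell k)) 0.

End riemannian_measure.

Section curvature.
Context {R : realType} {n : nat}.
Variable G : 'rV[R]_n -> 'M[R]_n.
Implicit Types (a b c d : 'I_n) (x : 'rV[R]_n).

Definition christoffel c a b : 'rV[R]_n -> R := fun x =>
  2^-1 * \sum_d invmx (G x) c d *
    (partial a (fun y => G y b d) x + partial b (fun y => G y a d) x
     - partial d (fun y => G y a b) x).

(* Sign convention: round spheres have positive curvature. *)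
Definition ricci a b : 'rV[R]_n -> R := fun x =>
  \sum_c (partial c (christoffel c a b) x - partial a (christoffel c c b) x
    + \sum_d (christoffel c c d x * christoffel d a b x
              - christoffel c a d x * christoffel d c b x)).

Definition scalar_curvature : 'rV[R]_n -> R := fun x =>
  \sum_a \sum_b invmx (G x) a b * ricci a b x.

End curvature.

Section yamabe.
Context {R : realType} {n : nat} {M : smooth_manifold R n}.
Variable g : metric M.

(* scal and sqnorm_diff do not depend on the choice of the chart at p. *)
Definition scal (p : M) : R :=
  let i := chart_at p in scalar_curvature (fun x => g i (par i x)) (crd i p).

(* |dv|_g^2 *)
Definition sqnorm_diff (v : M -> R) (p : M) : R :=
  let i := chart_at p in
  let dv := \row_a partial a (v \o par i) (crd i p) in
  (dv *m invmx (g i p) *m dv^T) 0 0.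

Definition test_function (v : M -> R) : Prop :=
  [/\ smooth v, compact (closure [set p | v p != 0]),
      forall p, 0 <= v p & exists p, v p != 0].

Definition yamabe_exponent : R := (2 * n%:R) / (n%:R - 2).

Definition yamabe_coef : R := (4 * (n%:R - 1)) / (n%:R - 2).

Definition yamabe_energy (v : M -> R) : R :=
  (\int[riemannian_measure g]_p
      (yamabe_coef * sqnorm_diff v p + scal p * v p ^+ 2))
  / fine ('N[riemannian_measure g]_(yamabe_exponent%:E) [EFin \o v]) ^+ 2.

Definition yamabe_constant : \bar R :=
  ereal_inf [set (yamabe_energy v)%:E | v in test_function].

End yamabe.

(* Main.v *)
Require Import Defs.
From mathcomp Require Import all_boot all_order all_algebra.
From mathcomp Require Import all_classical all_reals all_analysis.
From mathcomp Require Import measurable_realfun ring lra.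

Import Order.TTheory GRing.Theory Num.Theory.
Import numFieldNormedType.Exports.
Local Open Scope classical_set_scope.
Local Open Scope ring_scope.
Set Implicit Arguments.
Unset Strict Implicit.
Unset Printing Implicit Defensive.

(* A function v is compared with w = (1 - zeta ^ 2) v, where 0 < zeta <= 1/2 on the
   support of v.  The gradient term of w is at most (1 - zeta ^ 2 / 2) times the
   one of v, up to a multiple of |d zeta| ^ 2 v ^ 2, and a fine neighborhood of g
   controls the ratio of the densities, the ratio of the covector norms and the
   scalar curvatures of its elements h, all up to errors below zeta ^ 2 / 2.  The
   spare gradient pays for the change of the metric, so that the energies satisfy
   E_h(w) <= E_g(v) + int F v ^ 2 and vice versa, with F built from zeta and g
   alone.  Summing rapidly decreasing bump functions yields such a zeta with
   F <= 1 and int F <= 1, and then t ^ 2 <= 1 + t ^ p bounds int F v ^ 2 by a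
   multiple of the squared L^p norm of v, which is comparable to the one of w.
   Hence the Yamabe constants of g and h are finite simultaneously.

   The densities of two metrics are compared cell by cell, in the charts that
   define riemannian_measure, so that no change of variables is needed. *)

(** The obstacle is that M need not be compact and the scalar curvature need not be bounded below.
    Changing the metric costs a small multiple of |dv|^2 + v^2, and in general the energy and the
    L^p norm of v control neither term, so v cannot simply be compared with itself. The square in 1
    - zeta^2 matters: d(zeta^2) carries a factor zeta, which cancels the 1 / zeta^2 that Young's
    inequality with parameter zeta^2 / 2 puts in front of |d zeta|^2. The order of choices matters
    as well. Lower bounds [c k] for zeta on the cells depend on g only and fix the neighborhood. The
    function zeta is chosen later, when the support K of v is known, as a finite sum whose bounds do
    not depend on K. All errors are measured by g, also when energies pass from h to g. One
    neighborhood therefore serves both directions, which makes the set and its complement open. *)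

(** * Flat functions built from exp(-1/t) *)

Section flat_functions.
Context {R : realType}.
Implicit Types (p : {poly R}) (t x : R).

(** The polynomial factor makes the family closed under differentiation, so that smoothness follows
    from a single derivative formula. The bumps use p = 1. *)
Definition flat p t : R := if 0 < t then p.[t^-1] * expR (- t^-1) else 0.

Lemma poly_expRN_bounded p :
  exists2 C, 0 <= C & forall x, 0 <= x -> `|p.[x] * expR (- x)| <= C.
Proof.
have monom i x : 0 <= x -> x ^+ i * expR (- x) <= i`!%:R.
  move=> x0; rewrite expRN ler_pdivrMr ?expR_gt0//.
  case: i => [|i]; first by rewrite expr0 mul1r -expR0 ler_expR.
  have := expR_ge1Dxn i x0; set f : R := _%:R => le.
  have f0 : 0 < f by rewrite ltr0n fact_gt0.
  by rewrite mulrC -ler_pdivrMr// (le_trans _ le)// lerDr.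
exists (\sum_(i < size p) `|p`_i| * i`!%:R).
  by apply: sumr_ge0 => i _; rewrite mulr_ge0.
move=> x x0; rewrite horner_coef mulr_suml (le_trans (ler_norm_sum _ _ _))//.
apply: ler_sum => i _; rewrite -mulrA normrM ler_wpM2l//.
by rewrite ger0_norm ?monom// mulr_ge0 ?exprn_ge0// expR_ge0.
Qed.

(** The bound for p X^2 at 1/t, multiplied by t^2. It yields continuity at 0. *)
Lemma flat_le_sqr p : exists2 C, 0 <= C & forall t, `|flat p t| <= C * t ^+ 2.
Proof.
have [C C0 Cp] := poly_expRN_bounded (p * 'X ^+ 2).
exists C => // t; rewrite /flat; case: ifPn => [t0|_]; last first.
  by rewrite normr0 mulr_ge0// sqr_ge0.
have := Cp t^-1; rewrite invr_ge0 ltW// => /(_ erefl).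
rewrite hornerM hornerXn mulrAC normrM exprVn [X in _ * X]ger0_norm.
  by rewrite ler_pdivrMr// exprn_gt0.
by rewrite invr_ge0 sqr_ge0.
Qed.

Definition flat_deriv p : {poly R} := 'X ^+ 2 * (p - p^`()).

Lemma flat_continuous0 p : {for 0, continuous (flat p)}.
Proof.
have [C C0 Cp] := flat_le_sqr p.
apply/cvgrPdist_le => /= e e0; apply/nbhs_ballP.
exists (Num.min 1 (e / (C + 1))) => /=.
  by rewrite lt_min ltr01 divr_gt0// ltr_wpDl.
move=> t; rewrite /ball/= sub0r normrN lt_min => /andP[t1 te].
rewrite /(flat p 0) ltxx sub0r normrN (le_trans (Cp t))//.
rewrite -real_normK ?num_real// expr2.
rewrite (@le_trans _ _ ((C + 1) * `|t|))//; last first.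
  by rewrite mulrC -ler_pdivlMr ?ltW// ltr_wpDl.
by rewrite ler_pM ?mulr_ge0 ?lerDl// ler_piMl// ltW.
Qed.

Lemma is_derive_flat p t : is_derive t 1 (flat p) (flat (flat_deriv p) t).
Proof.
have [t0|t0|->] := ltgtP t 0.
- have : \near t, (fun=> 0 : R) t = flat p t.
    near=> s; rewrite /flat ifN// -leNgt ltW//; near: s.
    exact: lt_nbhsl.
  move=> /near_eq_is_derive; apply.
  rewrite /flat ifN -?leNgt ?ltW//; exact: is_derive_cst.
- have : \near t, (fun s => p.[s^-1] * expR (- s^-1)) t = flat p t.
    near=> s; rewrite /flat ifT//; near: s.
    exact: lt_nbhsr.
  move=> /near_eq_is_derive; apply.
  have tn0 : t != 0 by rewrite gt_eqF.
  have inv : is_derive t 1 (fun s : R => s^-1) (- t ^- 2 *: 1).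
    exact: (is_deriveV (f := id)).
  have dp := is_derive1_comp (is_derive_poly p t^-1) inv.
  have de : is_derive t 1 (fun s : R => expR (- s^-1)) (expR (- t^-1) * - (- t ^- 2 *: 1)).
    exact: (is_derive1_comp (f := expR) (is_derive_expR _) (is_deriveN inv)).
  apply: is_derive_eq (is_deriveM dp de) _; rewrite /flat t0 /flat_deriv/=.
  rewrite hornerM hornerXn hornerD hornerN exprVn /GRing.scale/=; ring.
- rewrite /(flat _ 0) ltxx; apply/is_derive1_caratheodory.
  (* At 0 the difference quotient of [flat p] is again a flat function, so differentiability reduces
     to continuity. *)
  exists (flat ('X * p)); split; last by rewrite /flat ltxx.
    move=> z; rewrite /flat ltxx !subr0; case: ifPn => z0; last by rewrite mul0r.
    by rewrite hornerM hornerX; field; rewrite gt_eqF.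
  exact: flat_continuous0.
Unshelve. all: by end_near. Qed.

Lemma flat_continuous p : continuous (flat p).
Proof.
move=> t; have [d _] := is_derive_flat p t.
by apply: differentiable_continuous; exact/derivable1_diffP.
Qed.

End flat_functions.

(** * Calculus of C^k functions on open sets *)

Section Ck_calculus.
Context {R : realType} {n : nat}.
Implicit Types (W V : set 'rV[R]_n) (f g : 'rV[R]_n -> R).

Lemma open_within_continuousP (T U : topologicalType) (W : set T) (f : T -> U) :
  open W ->
  {within W, continuous f} <-> forall x, W x -> {for x, continuous f}.
Proof.
move=> oW; rewrite continuous_open_subspace//; split => [+ x Wx|h x].
  by apply; rewrite inE.
by rewrite inE; exact: h.
Qed.

Lemma Ck_continuous k W f : Ck k W f -> {within W, continuous f}.
Proof. by case: k => [|k] []. Qed.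

Lemma Ck_pred k W f : Ck k.+1 W f -> Ck k W f.
Proof.
elim: k f => [|k IH] f [cf df]; split => // a.
by have [? /IH] := df a.
Qed.

Lemma Ck_local k W f : open W ->
  (forall x, W x -> exists V, [/\ open V, V x & Ck k V f]) -> Ck k W f.
Proof.
elim: k f => [|k IH] f oW loc; split => //.
- apply/open_within_continuousP => // x /loc[V [oV Vx [+ _]]].
  by move/(open_within_continuousP _ oV); apply.
- apply/open_within_continuousP => // x /loc[V [oV Vx [+ _]]].
  by move/(open_within_continuousP _ oV); apply.
- move=> a; split; first by move=> x /loc[V [oV Vx [_ /(_ a)[+ _]]]]; apply.
  by apply: IH => // x /loc[V [oV Vx [_ /(_ a)[_ Vf]]]]; exists V.
Qed.

Lemma partial_ext a W f g x : open W -> {in W, f =1 g} -> W x ->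
  partial a f x = partial a g x.
Proof.
move=> oW fg Wx; apply: near_eq_derive.
by apply: filterS (open_nbhs_nbhs (conj oW Wx)) => y Wy; apply: fg; rewrite inE.
Qed.

Lemma Ck_ext k W f g : open W -> {in W, f =1 g} -> Ck k W f -> Ck k W g.
Proof.
elim: k f g => [|k IH] f g oW fg [cf df].
  by split=> //; apply: subspace_eq_continuous cf.
split; first by apply: subspace_eq_continuous cf.
move=> a; have [da pa] := df a; split.
  move=> x Wx; apply: near_eq_derivable (da x Wx).
  by apply: filterS (open_nbhs_nbhs (conj oW Wx)) => y Wy; apply: fg; rewrite inE.
by apply: IH pa => // x; rewrite inE; exact: partial_ext.
Qed.

Lemma Ck_cst k W c : Ck k W (fun=> c).
Proof.
have c0 d : {within W, continuous (fun=> d : R)}.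
  by apply: continuous_subspaceT => x; exact: cst_continuous.
elim: k c => [|k IH] c; split => // a; split.
  by move=> x _; exact: derivable_cst.
suff -> : partial a (fun=> c) = (fun=> 0) :> ('rV[R]_n -> R) by exact: IH.
by apply/funext => x; exact: derive_cst.
Qed.

Lemma partialD a f g x : derivable f x (delta_mx 0 a) ->
  derivable g x (delta_mx 0 a) ->
  partial a (fun y => f y + g y) x = partial a f x + partial a g x.
Proof. exact: deriveD. Qed.

Lemma partialM a f g x : derivable f x (delta_mx 0 a) ->
  derivable g x (delta_mx 0 a) ->
  partial a (fun y => f y * g y) x = f x * partial a g x + g x * partial a f x.
Proof. exact: deriveM. Qed.

Lemma Ck_add k W f g : open W ->
  Ck k W f -> Ck k W g -> Ck k W (fun x => f x + g x).
Proof.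
move=> oW; elim: k f g => [|k IH] f g [cf df] [cg dg].
  by split=> //; move=> x; apply: cvgD; [exact: cf|exact: cg].
split; first by move=> x; apply: cvgD; [exact: cf|exact: cg].
move=> a; have [da pa] := df a; have [ea qa] := dg a; split.
  by move=> x Wx; apply: derivableD; [exact: da|exact: ea].
apply: (Ck_ext (f := fun x => partial a f x + partial a g x)) => //.
  by move=> x; rewrite inE => Wx; rewrite partialD//; [exact: da|exact: ea].
exact: IH.
Qed.

Lemma Ck_mul k W f g : open W ->
  Ck k W f -> Ck k W g -> Ck k W (fun x => f x * g x).
Proof.
move=> oW; elim: k f g => [|k IH] f g fk gk; have [cf df] := fk; have [cg dg] := gk.
  by split=> //; move=> x; apply: cvgM; [exact: cf|exact: cg].
split; first by move=> x; apply: cvgM; [exact: cf|exact: cg].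
move=> a; have [da pa] := df a; have [ea qa] := dg a; split.
  by move=> x Wx; apply: derivableM; [exact: da|exact: ea].
apply: (Ck_ext (f := fun x => f x * partial a g x + g x * partial a f x)) => //.
  by move=> x; rewrite inE => Wx; rewrite partialM//; [exact: da|exact: ea].
by apply: Ck_add => //; apply: IH => //; exact: Ck_pred.
Qed.

Lemma Ck_sum k W (I : Type) (r : seq I) (F : I -> 'rV[R]_n -> R) : open W ->
  (forall i, Ck k W (F i)) -> Ck k W (fun x => \sum_(i <- r) F i x).
Proof.
move=> oW WF; elim: r => [|i r IH].
  by apply: (Ck_ext (f := fun=> 0)) => [//|x _|]; [rewrite big_nil|exact: Ck_cst].
apply: (Ck_ext (f := fun x => F i x + \sum_(i <- r) F i x)) => [//|x _|].
  by rewrite big_cons.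
exact: Ck_add.
Qed.

Lemma Ck_prod k W (I : Type) (r : seq I) (F : I -> 'rV[R]_n -> R) : open W ->
  (forall i, Ck k W (F i)) -> Ck k W (fun x => \prod_(i <- r) F i x).
Proof.
move=> oW WF; elim: r => [|i r IH].
  by apply: (Ck_ext (f := fun=> 1)) => [//|x _|]; [rewrite big_nil|exact: Ck_cst].
apply: (Ck_ext (f := fun x => F i x * \prod_(i <- r) F i x)) => [//|x _|].
  by rewrite big_cons.
exact: Ck_mul.
Qed.

(** Restriction to the line through x in direction v, where the one-variable chain rule applies. *)
Lemma is_derive_lineP f x v (d : R) :
  is_derive x v f d <-> is_derive 0 (1 : R) (fun t : R => f (t *: v + x)) d.
Proof.
have E : (fun h : R => h^-1 *: (((fun t : R => f (t *: v + x)) \o shift 0)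
      (h *: 1) - f (0 *: v + x))) =
    (fun h : R => h^-1 *: ((f \o shift x) (h *: v) - f x)).
  by apply/funext => h; rewrite /= addr0 scale0r add0r [h *: 1]mulr1.
have D : 'D_1 (fun t : R => f (t *: v + x)) 0 = 'D_v f x.
  by rewrite /derive E.
split=> [[df dE]|[df dE]].
  by apply: DeriveDef; [rewrite -derivable1P|rewrite D].
by apply: DeriveDef; [rewrite derivable1P|rewrite -D].
Qed.

Lemma is_derive_comp_real (rho : R -> R) f x v d e :
  is_derive (f x) 1 rho d -> is_derive x v f e ->
  is_derive x v (rho \o f) (d * e).
Proof.
move=> drho /is_derive_lineP df; apply/is_derive_lineP.
have := @is_derive1_comp R rho (fun t : R => f (t *: v + x)) 0 d e.
by rewrite scale0r add0r; apply.
Qed.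

(** The induction on k keeps p general, since differentiation replaces p by [flat_deriv p]. *)
Lemma Ck_flat k W p f : open W -> Ck k W f -> Ck k W (fun x => flat p (f x)).
Proof.
move=> oW; elim: k p f => [|k IH] p f fk; have [cf df] := fk.
  by split=> // x; apply: continuous_comp; [exact: cf|exact: flat_continuous].
split.
  by move=> x; apply: continuous_comp; [exact: cf|exact: flat_continuous].
have dp a x : W x -> is_derive x (delta_mx 0 a) (flat p \o f)
    (flat (flat_deriv p) (f x) * partial a f x).
  move=> Wx; apply: is_derive_comp_real; first exact: is_derive_flat.
  by apply/derivableP; have [+ _] := df a; apply.
move=> a; split; first by move=> x /(dp a)[].
apply: (Ck_ext (f := fun x => flat (flat_deriv p) (f x) * partial a f x)) => //.
  by move=> x; rewrite inE => /(dp a)[_ <-].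
apply: Ck_mul => //; last by have [] := df a.
by apply: IH; exact: Ck_pred.
Qed.

Lemma smooth_continuous W f : smooth_on W f -> {within W, continuous f}.
Proof. by move=> /(_ 0%N)/Ck_continuous. Qed.

Lemma smooth_partial W f a : smooth_on W f -> smooth_on W (partial a f).
Proof. by move=> Wf k; have [_ /(_ a)[]] := Wf k.+1. Qed.

Lemma smooth_derivable W f a x : smooth_on W f -> W x ->
  derivable f x (delta_mx 0 a).
Proof. by move=> /(_ 1%N)[_ /(_ a)[+ _]] Wx; apply. Qed.

End Ck_calculus.

(** * Positive definite quadratic forms *)

Section quadratic_forms.
Context {R : realType} {n : nat}.
Implicit Types (A B P : 'M[R]_n) (u w : 'rV[R]_n).

Definition qf A u : R := (u *m A *m u^T) 0 0.

Definition posdef A := A^T = A /\ forall u, u != 0 -> 0 < qf A u.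

Lemma qfE A u : qf A u = \sum_a \sum_b u 0 a * A a b * u 0 b.
Proof.
rewrite /qf mxE exchange_big/=; apply: eq_bigr => b _.
by rewrite !mxE mulr_suml.
Qed.

Lemma qf0 A : qf A 0 = 0.
Proof. by rewrite /qf mul0mx mul0mx mxE. Qed.

Lemma qfZ A (t : R) u : qf A (t *: u) = t ^+ 2 * qf A u.
Proof. by rewrite /qf linearZ/= -scalemxAl -scalemxAr -scalemxAl scalerA !mxE. Qed.

Lemma qfDl A B u : qf (A + B) u = qf A u + qf B u.
Proof. by rewrite /qf mulmxDr mulmxDl mxE. Qed.

Lemma qfNl A u : qf (- A) u = - qf A u.
Proof. by rewrite /qf mulmxN mulNmx mxE. Qed.

Lemma qfZl A (t : R) u : qf (t *: A) u = t * qf A u.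
Proof. by rewrite /qf -scalemxAr -scalemxAl mxE. Qed.

Lemma posdef_ge0 P u : posdef P -> 0 <= qf P u.
Proof. by move=> [_ p]; have [->|/p/ltW//] := eqVneq u 0; rewrite qf0. Qed.

Lemma qf_add P u w : P^T = P ->
  qf P (u + w) = qf P u + 2 * (u *m P *m w^T) 0 0 + qf P w.
Proof.
move=> sP; have E : (w *m P *m u^T) 0 0 = (u *m P *m w^T) 0 0.
  transitivity ((w *m P *m u^T)^T 0 0); first by rewrite [RHS]mxE.
  by rewrite !trmx_mul trmxK sP mulmxA.
rewrite /qf linearD/= !mulmxDl !mulmxDr [LHS]mxE [in LHS]mxE [X in _ + X = _]mxE.
by rewrite E; ring.
Qed.

(** Young's inequality: positivity of the form at s u - w, divided by s, bounds the cross term. *)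
Lemma qf_add_le P u w (s : R) : posdef P -> 0 < s ->
  qf P (u + w) <= (1 + s) * qf P u + (1 + s^-1) * qf P w.
Proof.
move=> pP s0; have [sP _] := pP.
have := posdef_ge0 (s *: u + - 1 *: w) pP.
rewrite (qf_add (s *: u) (-1 *: w) sP) !qfZ.
have -> : (s *: u *m P *m (-1 *: w)^T) 0 0 = s * (-1 * (u *m P *m w^T) 0 0).
  by rewrite linearZ/= -!scalemxAl -scalemxAr [LHS]mxE [in LHS]mxE.
move=> h.
rewrite qf_add//; set b := (u *m P *m w^T) 0 0 in h *.
have : 0 <= s^-1 * (s ^+ 2 * qf P u + 2 * (s * (-1 * b)) + (-1) ^+ 2 * qf P w).
  by rewrite mulr_ge0// invr_ge0 ltW.
have -> : s^-1 * (s ^+ 2 * qf P u + 2 * (s * (-1 * b)) + (-1) ^+ 2 * qf P w) =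
  s * qf P u - 2 * b + s^-1 * qf P w by field; rewrite gt_eqF.
lra.
Qed.

Lemma posdef_unit P : posdef P -> P \in unitmx.
Proof.
move=> [sP pP]; rewrite -row_free_unit -kermx_eq0; apply/negP => /negP.
move=> /rowV0Pn[u uk un0].
have := pP u un0; rewrite /qf; move/sub_kermxP : uk => ->.
by rewrite mul0mx mxE ltxx.
Qed.

Lemma posdef_inv P : posdef P -> posdef (invmx P).
Proof.
move=> pP; have uP := posdef_unit pP; have [sP p] := pP.
have sI : (invmx P)^T = invmx P by rewrite trmx_inv sP.
split=> // u un0.
have -> : qf (invmx P) u = qf P (u *m invmx P).
  by rewrite /qf trmx_mul sI -!mulmxA mulKVmx.
apply: p; apply: contraNneq un0 => /(congr1 (mulmx^~ P)).
by rewrite mulmxKV// mul0mx => ->.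
Qed.

Lemma qf_delta P a : qf P (delta_mx 0 a) = P a a.
Proof. by rewrite /qf -rowE trmx_delta -colE !mxE. Qed.

Lemma posdef_diag P a : posdef P -> 0 < P a a.
Proof.
move=> [_ p]; rewrite -qf_delta; apply: p; apply/eqP => /matrixP/(_ 0 a).
by rewrite !mxE !eqxx/=; apply/eqP/oner_neq0.
Qed.

(* Cauchy-Schwarz for the form P^-1, applied to u and the row a of P. *)
Lemma posdef_coord_le P u a : posdef P ->
  u 0 a ^+ 2 <= P a a * qf (invmx P) u.
Proof.
move=> pP; have uP := posdef_unit pP; have pI := posdef_inv pP.
have [sI _] := pI; have Pa := posdef_diag a pP; have [sP _] := pP.
(* The coefficient minimizes the form P^-1 on the line through u in the direction of the row. *)
have := posdef_ge0 (u + (- (u 0 a / P a a)) *: row a P) pI.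
rewrite qf_add// qfZ linearZ/= -scalemxAr [X in 2 * X]mxE.
have -> : (u *m invmx P *m (row a P)^T) 0 0 = u 0 a.
  by rewrite tr_row sP colE !mulmxA mulmxKV// -colE !mxE.
have -> : qf (invmx P) (row a P) = P a a.
  rewrite /qf tr_row sP rowE colE !mulmxA -(mulmxA _ P (invmx P)) mulmxV//.
  by rewrite mulmx1 -rowE -colE !mxE.
move=> h; rewrite -subr_ge0.
have -> : P a a * qf (invmx P) u - u 0 a ^+ 2 =
  P a a * (qf (invmx P) u + 2 * (- (u 0 a / P a a) * u 0 a) +
    (- (u 0 a / P a a)) ^+ 2 * P a a) by field; rewrite gt_eqF.
by rewrite mulr_ge0// ltW.
Qed.

(** Every coordinate of u satisfies u_a^2 <= tr P * P^-1(u), and 2 |u_a u_b| <= u_a^2 + u_b^2. This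
    is how a bound on matrix entries becomes one relative to a metric, and the source of the trace
    in [jet_gap]. *)
Lemma qf_le_tr P B u : posdef P ->
  `|qf B u| <= (\sum_a \sum_b `|B a b|) * \tr P * qf (invmx P) u.
Proof.
move=> pP; have q0 := posdef_ge0 u (posdef_inv pP).
have le a : u 0 a ^+ 2 <= \tr P * qf (invmx P) u.
  rewrite (le_trans (posdef_coord_le u a pP))// ler_wpM2r// /mxtrace.
  rewrite (bigD1 a)//= lerDl sumr_ge0// => b _; exact/ltW/posdef_diag.
rewrite qfE -mulrA mulr_suml (le_trans (ler_norm_sum _ _ _))//.
apply: ler_sum => a _; rewrite mulr_suml (le_trans (ler_norm_sum _ _ _))//.
apply: ler_sum => b _; rewrite mulrAC mulrC normrM ler_wpM2l//.
have := le a; have := le b; set X := \tr P * _ => hb ha.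
have : 0 <= (`|u 0 a| - `|u 0 b|) ^+ 2 by exact: sqr_ge0.
rewrite normrM; move: ha hb; rewrite -(real_normK (num_real (u 0 a))).
rewrite -(real_normK (num_real (u 0 b))); nra.
Qed.

End quadratic_forms.

(** * Limits of matrices, determinants and inverses *)

Section matrix_limits.
Context {R : realType}.

(** The entries lie in any topological space, so that the matrices of matrices in [jet_model] are
    covered too. *)
Lemma cvg_mxP (T : topologicalType) (S : Type) (F : set_system S) m n
    (f : S -> 'M[T]_(m, n)) (A : 'M[T]_(m, n)) : Filter F ->
  (f @ F --> A) <-> (forall i j, f x i j @[x --> F] --> A i j).
Proof.
move=> FF; split=> [fA i j B BA|fA B [P PA PB]].
  apply: (fA [set M | B (M i j)]).
  exists (fun i' j' => [set x | (i' = i -> j' = j -> B x)]) => /=.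
    move=> i' j'.
    have [[-> ->]|ne] := pselect (i' = i /\ j' = j).
      by apply: filterS BA => x Bx _ _.
    by apply: filterE => x /= ? ?; exfalso; apply: ne.
  by move=> M /(_ i j)/(_ erefl erefl).
apply: filterS (PB) _ => /=.
have : \forall x \near F, forall i, forall j, P i j (f x i j).
  apply: filter_forall => i; apply: filter_forall => j.
  by apply: fA; exact: PA.
by [].
Qed.

Context {S : Type} {F : set_system S} {FF : Filter F}.

Lemma cvg_bigsum (I : Type) (r : seq I) (p : pred I) (f : I -> S -> R) (l : I -> R) :
  (forall i, p i -> f i x @[x --> F] --> l i) ->
  \sum_(i <- r | p i) f i x @[x --> F] --> \sum_(i <- r | p i) l i.
Proof. by apply: cvg_big; exact: add_continuous. Qed.

Lemma cvg_bigprod (I : Type) (r : seq I) (p : pred I) (f : I -> S -> R) (l : I -> R) :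
  (forall i, p i -> f i x @[x --> F] --> l i) ->
  \prod_(i <- r | p i) f i x @[x --> F] --> \prod_(i <- r | p i) l i.
Proof. by apply: cvg_big; exact: mul_continuous. Qed.

Lemma cvg_mulmx m n p (f : S -> 'M[R]_(m, n)) (g : S -> 'M[R]_(n, p))
    (A : 'M[R]_(m, n)) (B : 'M[R]_(n, p)) :
  f @ F --> A -> g @ F --> B -> f x *m g x @[x --> F] --> A *m B.
Proof.
move=> /cvg_mxP fA /cvg_mxP gB; apply/cvg_mxP => i j.
rewrite mxE; under eq_fun do rewrite mxE.
by apply: cvg_bigsum => k _; apply: cvgM.
Qed.

Lemma cvg_trmx m n (f : S -> 'M[R]_(m, n)) (A : 'M[R]_(m, n)) :
  f @ F --> A -> (f x)^T @[x --> F] --> A^T.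
Proof.
move=> /cvg_mxP fA; apply/cvg_mxP => i j.
have -> : (fun x => (f x)^T i j) = fun x => f x j i.
  by apply/funext => x; rewrite mxE.
by rewrite mxE.
Qed.

Lemma cvg_det n (f : S -> 'M[R]_n) (A : 'M[R]_n) : f @ F --> A ->
  \det (f x) @[x --> F] --> \det A.
Proof.
move=> /cvg_mxP fA; apply: cvg_bigsum => s _; apply: cvgM; first exact: cvg_cst.
by apply: cvg_bigprod => i _.
Qed.

Lemma cvg_mxtrace n (f : S -> 'M[R]_n) (A : 'M[R]_n) : f @ F --> A ->
  \tr (f x) @[x --> F] --> \tr A.
Proof. by move=> /cvg_mxP fA; apply: cvg_bigsum. Qed.

Lemma cvg_adjugate n (f : S -> 'M[R]_n) (A : 'M[R]_n) : f @ F --> A ->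
  \adj (f x) @[x --> F] --> \adj A.
Proof.
move=> /cvg_mxP fA; apply/cvg_mxP => i j; rewrite mxE /cofactor.
under eq_fun do rewrite mxE /cofactor.
apply: cvgM; first exact: cvg_cst.
apply: cvg_det; apply/cvg_mxP => k l; rewrite !mxE.
have -> : (fun x => row' j (col' i (f x)) k l) =
    fun x => f x (lift j k) (lift i l) by apply/funext => x; rewrite !mxE.
exact: fA.
Qed.

Lemma cvg_near_det_neq0 n (f : S -> 'M[R]_n) (A : 'M[R]_n) :
  \det A != 0 -> f @ F --> A -> \forall x \near F, \det (f x) != 0.
Proof.
move=> dA /cvg_det dfA.
by apply: (dfA [set y | y != 0]); apply: open_nbhs_nbhs; split.
Qed.

(** Since [invmx] returns a singular argument unchanged, the adjugate formula is used only where the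
    determinant is nonzero, which holds near the limit. *)
Lemma cvg_invmx n (f : S -> 'M[R]_n) (A : 'M[R]_n) : \det A != 0 -> f @ F --> A ->
  invmx (f x) @[x --> F] --> invmx A.
Proof.
move=> dA fA; have dfA := cvg_det fA.
have uA (B : 'M[R]_n) : \det B != 0 -> invmx B = (\det B)^-1 *: \adj B.
  by move=> dB; rewrite /invmx unitmxE unitfE dB.
have nz := cvg_near_det_neq0 dA fA; rewrite uA//.
apply: cvg_trans (_ : (\det (f x))^-1 *: \adj (f x) @[x --> F] --> _).
  apply: near_eq_cvg; near=> x; rewrite uA//; near: x; exact: nz.
have /cvg_mxP ad := cvg_adjugate fA.
apply/cvg_mxP => i j; rewrite mxE; under eq_fun do rewrite mxE.
by apply: cvgM => //; exact: cvgV.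
Unshelve. all: by end_near. Qed.

Lemma cvg_qf n (f : S -> 'M[R]_n) (u : S -> 'rV[R]_n)
    (A : 'M[R]_n) (w : 'rV[R]_n) :
  f @ F --> A -> u @ F --> w -> qf (f x) (u x) @[x --> F] --> qf A w.
Proof.
move=> fA uw.
have /cvg_mxP : u x *m f x *m (u x)^T @[x --> F] --> w *m A *m w^T.
  by apply: cvg_mulmx; [exact: cvg_mulmx|exact: cvg_trmx].
exact.
Qed.

End matrix_limits.

(** The segment from P to the identity consists of positive definite, hence invertible, matrices. By
    the intermediate value theorem the determinant keeps the sign that it has at the identity. *)
Lemma posdef_det_gt0 (R : realType) n (P : 'M[R]_n) : posdef P -> 0 < \det P.
Proof.
move=> pP.
pose M (t : R) : 'M[R]_n := t *: 1%:M + (1 - t) *: P.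
have p1 (u : 'rV[R]_n) : u != 0 -> 0 < qf 1%:M u.
  move=> un0; rewrite qfE; have /rV0Pn[a ua] := un0.
  rewrite (bigD1 a)//= ltr_pwDl//.
    rewrite (bigD1 a)//= mxE eqxx mulr1 big1 ?addr0 ?lt0r ?mulf_neq0 -?expr2 ?sqr_ge0//.
    by move=> b; rewrite mxE eq_sym => /negPf ->; rewrite mulr0 mul0r.
  apply: sumr_ge0 => b _; rewrite (bigD1 b)//= mxE eqxx mulr1 big1 ?addr0 -?expr2 ?sqr_ge0//.
  by move=> c; rewrite mxE eq_sym => /negPf ->; rewrite mulr0 mul0r.
have pM t : 0 <= t <= 1 -> posdef (M t).
  move=> /andP[t0 t1]; have [sP p] := pP; split.
    by rewrite /M linearD !linearZ/= trmx1 sP.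
  move=> u un0; rewrite /M qfDl !qfZl; have := p1 u un0; have := p u un0.
  by move=> *; have [->|] := eqVneq t 0; nra.
have cM : {within `[0, 1], continuous (fun t => \det (M t))}.
  apply: continuous_subspaceT => t; apply: cvg_det; apply/(@cvg_mxP R) => i j.
  rewrite !mxE; under eq_fun do rewrite !mxE.
  apply: cvgD; apply: cvgM; (try exact: cvg_cst); first exact: cvg_id.
  by apply: cvgB; [exact: cvg_cst|exact: cvg_id].
rewrite ltNge; apply/negP => d0.
have [|c c01 dc] := @IVT R _ 0 1 0 ler01 cM.
  rewrite /M scale0r add0r subr0 scale1r subrr scale0r addr0 scale1r det1.
by rewrite ge_min le_max d0 ler01 orbT.
have := posdef_unit (pM c c01).
by rewrite unitmxE unitfE dc eqxx.
Qed.

Section derive_invmx.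
Context {R : realType} {V : normedModType R} {n : nat}.

(** From the identity A^-1 - B^-1 = - A^-1 (A - B) B^-1, applied to difference quotients. *)
Lemma is_derive_invmx (G : V -> 'M[R]_n) x v D :
  {for x, continuous G} -> \det (G x) != 0 -> is_derive x v G D ->
  is_derive x v (fun y => invmx (G y)) (- (invmx (G x) *m D *m invmx (G x))).
Proof.
move=> cG dG [/cvg_ex[l Gl] GD].
have lD : l = D by rewrite -GD; apply/esym/cvg_lim.
rewrite {}lD in Gl.
have sh : shift x (h *: v) @[h --> 0^'] --> x.
  apply: cvg_trans (_ : shift x (h *: v) @[h --> 0] --> x).
    apply: cvg_app; exact: cvg_within.
  rewrite -[X in _ --> X]add0r -(scale0r v).
  apply: cvgD; last exact: cvg_cst.
  by apply: cvgZr_tmp; exact: cvg_id.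
have cGs : G (shift x (h *: v)) @[h --> 0^'] --> G x.
  by move=> B /cG /sh.
have uE B : (B \in unitmx) = (\det B != 0 :> R) by rewrite unitmxE unitfE.
have nz : \forall h \near 0^', \det (G (shift x (h *: v))) != 0.
  exact: cvg_near_det_neq0 dG cGs.
have key : h^-1 *: (((fun y => invmx (G y)) \o shift x) (h *: v) - invmx (G x))
    @[h --> 0^'] --> (- (invmx (G x) *m D *m invmx (G x))).
  apply: cvg_trans (_ : - (invmx (G (shift x (h *: v))) *m
    (h^-1 *: ((G \o shift x) (h *: v) - G x)) *m invmx (G x)) @[h --> 0^'] --> _).
    apply: near_eq_cvg; near=> h.
    have uh : G (shift x (h *: v)) \in unitmx by rewrite uE; near: h.
    rewrite /= -scalemxAr -scalemxAl -scalerN mulmxBr mulVmx// mulmxBl mul1mx.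
    by rewrite -mulmxA mulmxV ?uE// mulmx1 opprB.
  apply: cvgN; apply: cvg_mulmx; last exact: cvg_cst.
  by apply: cvg_mulmx => //; exact: cvg_invmx.
apply: DeriveDef; first by apply/cvg_ex; eexists; exact: key.
exact: cvg_lim key.
Unshelve. all: by end_near. Qed.

End derive_invmx.

Lemma continuous_mxP (T U : topologicalType) m n (f : T -> 'M[U]_(m, n)) x :
  {for x, continuous f} <-> forall i j, {for x, continuous (fun y => f y i j)}.
Proof. exact: cvg_mxP. Qed.

Lemma continuous_pair (T U V : topologicalType) (f : T -> U) (g : T -> V) x :
  {for x, continuous f} -> {for x, continuous g} ->
  {for x, continuous (fun y => (f y, g y))}.
Proof. by move=> cf cg; exact: cvg_pair cf cg. Qed.

(** * Scalar curvature as a continuous function of the 2-jet *)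

Section curvature_of_jets.
Context {R : realType} {n : nat}.
Local Notation model :=
  ('rV[R]_n * 'M[R]_n * 'rV['M[R]_n]_n * 'M['M[R]_n]_n)%type.
Implicit Types (m : model) (a b c d e : 'I_n) (G : 'rV[R]_n -> 'M[R]_n).

Definition jet_inv m : 'M[R]_n := invmx m.1.1.2.

(** Twice the Christoffel symbols of the first kind. Below, [jet_dbracket], [jet_dinv] and
    [jet_dchristoffel] are formal derivatives in direction e, written with the data of the jet
    alone. *)
Definition jet_bracket m a b d : R := m.1.2 0 a b d + m.1.2 0 b a d - m.1.2 0 d a b.

Definition jet_dbracket m e a b d : R :=
  m.2 e a b d + m.2 e b a d - m.2 e d a b.

Definition jet_dinv m e : 'M[R]_n := - (jet_inv m *m m.1.2 0 e *m jet_inv m).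

Definition jet_christoffel m c a b : R :=
  2^-1 * \sum_d jet_inv m c d * jet_bracket m a b d.

Definition jet_dchristoffel m e c a b : R :=
  2^-1 * \sum_d (jet_inv m c d * jet_dbracket m e a b d
                 + jet_bracket m a b d * jet_dinv m e c d).

(** Second derivatives of the metric enter here, through [jet_dchristoffel]; this is what calls for
    the C^2-topology. *)
Definition jet_scal m : R :=
  \sum_a \sum_b jet_inv m a b *
    \sum_c (jet_dchristoffel m c c a b - jet_dchristoffel m a c c b
      + \sum_d (jet_christoffel m c c d * jet_christoffel m d a b
              - jet_christoffel m c a d * jet_christoffel m d c b)).

Definition jet_of G (x : 'rV[R]_n) : model :=
  (x, G x,
   \row_a \matrix_(c, d) partial a (fun y => G y c d) x,
   \matrix_(a, b) \matrix_(c, d) partial a (partial b (fun y => G y c d)) x).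

Lemma cvg_jet (S : Type) (F : set_system S) (f : S -> model) m : Filter F ->
  f @ F --> m ->
  [/\ ((f x).1.1.1 @[x --> F] --> m.1.1.1), ((f x).1.1.2 @[x --> F] --> m.1.1.2),
      (forall a b c, (f x).1.2 0 a b c @[x --> F] --> m.1.2 0 a b c) &
      (forall a b c d, (f x).2 a b c d @[x --> F] --> m.2 a b c d)].
Proof.
move=> FF fm.
have f1 : (f x).1 @[x --> F] --> m.1 by apply: cvg_comp fm _; exact: cvg_fst.
have f2 : (f x).2 @[x --> F] --> m.2 by apply: cvg_comp fm _; exact: cvg_snd.
have f11 : (f x).1.1 @[x --> F] --> m.1.1 by apply: cvg_comp f1 _; exact: cvg_fst.
have f12 : (f x).1.2 @[x --> F] --> m.1.2 by apply: cvg_comp f1 _; exact: cvg_snd.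
split.
- by apply: cvg_comp f11 _; exact: cvg_fst.
- by apply: cvg_comp f11 _; exact: cvg_snd.
- move=> a b c; move/cvg_mxP : f12 => /(_ 0 a) h.
  by move/(@cvg_mxP R) : h => /(_ b c).
- move=> a b c d; move/cvg_mxP : f2 => /(_ a b) h.
  by move/(@cvg_mxP R) : h => /(_ c d).
Qed.

Section limits.
Context {S : Type} {F : set_system S} {FF : Filter F}.
Variables (f : S -> model) (m : model).
Hypothesis fm : f @ F --> m.
Hypothesis dm : \det m.1.1.2 != 0.

Lemma cvg_jet_inv : jet_inv (f x) @[x --> F] --> jet_inv m.
Proof. by have [_ h _ _] := cvg_jet FF fm; exact: cvg_invmx. Qed.

Lemma cvg_jet_bracket a b d :
  jet_bracket (f x) a b d @[x --> F] --> jet_bracket m a b d.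
Proof.
by have [_ _ h _] := cvg_jet FF fm; apply: cvgB; [apply: cvgD|]; exact: h.
Qed.

Lemma cvg_jet_dbracket e a b d :
  jet_dbracket (f x) e a b d @[x --> F] --> jet_dbracket m e a b d.
Proof.
by have [_ _ _ h] := cvg_jet FF fm; apply: cvgB; [apply: cvgD|]; exact: h.
Qed.

Lemma cvg_jet_dinv e : jet_dinv (f x) e @[x --> F] --> jet_dinv m e.
Proof.
have [_ _ h _] := cvg_jet FF fm; apply: cvgN.
apply: cvg_mulmx; last exact: cvg_jet_inv.
by apply: cvg_mulmx; [exact: cvg_jet_inv|apply/(@cvg_mxP R) => a b; exact: h].
Qed.

Lemma cvg_jet_christoffel c a b :
  jet_christoffel (f x) c a b @[x --> F] --> jet_christoffel m c a b.
Proof.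
have /(@cvg_mxP R) inv := cvg_jet_inv.
apply: cvgM; first exact: cvg_cst.
apply: cvg_bigsum => d _.
by apply: cvgM; [exact: inv|exact: cvg_jet_bracket].
Qed.

Lemma cvg_jet_dchristoffel e c a b :
  jet_dchristoffel (f x) e c a b @[x --> F] --> jet_dchristoffel m e c a b.
Proof.
have /(@cvg_mxP R) inv := cvg_jet_inv; have /(@cvg_mxP R) dinv := @cvg_jet_dinv e.
apply: cvgM; first exact: cvg_cst.
apply: cvg_bigsum => d _.
apply: cvgD; apply: cvgM; [exact: inv|exact: cvg_jet_dbracket|
  exact: cvg_jet_bracket|exact: dinv].
Qed.

Lemma cvg_jet_scal : jet_scal (f x) @[x --> F] --> jet_scal m.
Proof.
have /(@cvg_mxP R) inv := cvg_jet_inv.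
apply: cvg_bigsum => a _; apply: cvg_bigsum => b _; apply: cvgM; first exact: inv.
apply: cvg_bigsum => c _; apply: cvgD.
  by apply: cvgB; exact: cvg_jet_dchristoffel.
by apply: cvg_bigsum => d _; apply: cvgB; apply: cvgM;
  exact: cvg_jet_christoffel.
Qed.

End limits.

Section smooth_field.
Variables (W : set 'rV[R]_n) (G : 'rV[R]_n -> 'M[R]_n).
Hypothesis oW : open W.
Hypothesis sG : forall c d, smooth_on W (fun x => G x c d).

Lemma smooth_on_continuous_at (f : 'rV[R]_n -> R) x :
  smooth_on W f -> W x -> {for x, continuous f}.
Proof. by move=> /smooth_continuous /(open_within_continuousP _ oW); apply. Qed.

Lemma jet_of_continuous x : W x -> {for x, continuous (jet_of G)}.
Proof.
move=> Wx.
have G0 : G y @[y --> x] --> G x.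
  by apply/continuous_mxP => c d; exact: smooth_on_continuous_at (sG c d) Wx.
have G1 : \row_a \matrix_(c, d) partial a (fun y => G y c d) y @[y --> x] -->
    \row_a \matrix_(c, d) partial a (fun y => G y c d) x.
  apply/continuous_mxP => i a; apply/continuous_mxP => c d.
  have := smooth_on_continuous_at (smooth_partial a (sG c d)) Wx.
  by congr (continuous_at _ _); apply/funext => y; rewrite !mxE.
have G2 : \matrix_(a, b) \matrix_(c, d) partial a (partial b (fun y => G y c d)) y
    @[y --> x] -->
    \matrix_(a, b) \matrix_(c, d) partial a (partial b (fun y => G y c d)) x.
  apply/continuous_mxP => a b; apply/continuous_mxP => c d.
  have := smooth_on_continuous_at (smooth_partial a (smooth_partial b (sG c d))) Wx.
  by congr (continuous_at _ _); apply/funext => y; rewrite !mxE.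
have G_ : {for x, continuous (fun y : 'rV[R]_n => y)} by exact: cvg_id.
apply: (@continuous_pair _ _ _ (fun y => (y, G y, \row_a \matrix_(c, d)
  partial a (fun z => G z c d) y))); last exact: G2.
apply: (@continuous_pair _ _ _ (fun y => (y, G y))); last exact: G1.
exact: continuous_pair G_ G0.
Qed.

Hypothesis dG : forall x, W x -> \det (G x) != 0.

Lemma is_partial_invmx x e c d : W x ->
  is_derive x (delta_mx 0 e) (fun y => invmx (G y) c d)
    (jet_dinv (jet_of G x) e c d).
Proof.
move=> Wx.
have dGx : derivable G x (delta_mx 0 e).
  by apply/derivable_mxP => a b; exact: smooth_derivable (sG a b) Wx.
have G0 : {for x, continuous G}.
  by apply/continuous_mxP => a b; exact: smooth_on_continuous_at (sG a b) Wx.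
have [dI DI] := is_derive_invmx G0 (dG Wx) (derivableP dGx).
apply: DeriveDef; first by move/derivable_mxP : dI; exact.
have := congr1 (fun M : 'M[R]_n => M c d) DI; rewrite derive_mx// mxE => ->.
have -> : 'D_(delta_mx 0 e) G x = (jet_of G x).1.2 0 e.
  by rewrite (derive_mx dGx); apply/matrixP => a b; rewrite !mxE.
by [].
Qed.

Lemma is_partial_christoffel x e c a b : W x ->
  is_derive x (delta_mx 0 e) (christoffel G c a b)
    (jet_dchristoffel (jet_of G x) e c a b).
Proof.
move=> Wx.
pose br d := fun y => partial a (fun z => G z b d) y +
  partial b (fun z => G z a d) y - partial d (fun z => G z a b) y.
have dbr d : is_derive x (delta_mx 0 e) (br d)
    (jet_dbracket (jet_of G x) e a b d).
  have dp u v w : is_derive x (delta_mx 0 e) (partial u (fun z => G z v w))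
      (partial e (partial u (fun z => G z v w)) x).
    by apply: derivableP; exact: smooth_derivable (smooth_partial u (sG v w)) Wx.
  have := is_deriveB (is_deriveD (dp a b d) (dp b a d)) (dp d a b).
  by move=> /is_derive_eq; apply; rewrite /jet_dbracket/= !mxE.
have := is_deriveZ 2^-1 (is_derive_sum (fun d => is_deriveM (is_partial_invmx e c d Wx) (dbr d))).
have -> : christoffel G c a b = 2^-1 \*: (\sum_d ((fun y => invmx (G y) c d) * br d)).
  by apply/funext => y; rewrite /christoffel/= fct_sumE.
move=> /is_derive_eq; apply; congr (_ * _); apply: eq_bigr => d _.
by rewrite /jet_bracket /br /jet_inv/= !mxE.
Qed.

Lemma scalar_curvature_jet x : W x ->
  scalar_curvature G x = jet_scal (jet_of G x).
Proof.
move=> Wx.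
have chr c a b : christoffel G c a b x = jet_christoffel (jet_of G x) c a b.
  congr (_ * _); apply: eq_bigr => d _.
  by rewrite /jet_inv /jet_bracket/= !mxE.
have dchr e c a b : partial e (christoffel G c a b) x =
    jet_dchristoffel (jet_of G x) e c a b.
  by have [_ <-] := is_partial_christoffel e c a b Wx.
rewrite /scalar_curvature /ricci.
apply: eq_bigr => a _; apply: eq_bigr => b _; congr (_ * _).
apply: eq_bigr => c _; rewrite !dchr; congr (_ + _).
by apply: eq_bigr => d _; rewrite !chr.
Qed.

End smooth_field.
End curvature_of_jets.

(** * A numerical gap between 2-jets of metrics *)

Section jet_gap.
Context {R : realType} {n : nat}.
Local Notation model :=
  ('rV[R]_n * 'M[R]_n * 'rV['M[R]_n]_n * 'M['M[R]_n]_n)%type.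
Implicit Types (J m : model) (G H : 'rV[R]_n -> 'M[R]_n).

Definition vol_ratio (A B : 'M[R]_n) : R :=
  Num.sqrt (\det B) / Num.sqrt (\det A).

(* Bounds the relative errors that are made in the volume, in the norm of
   covectors times the volume, and in the scalar curvature times the volume
   when the metric with 2-jet J is replaced by the one with 2-jet m. *)
Definition jet_gap J m : R :=
  let r := vol_ratio J.1.1.2 m.1.1.2 in
  `|r - 1|
  + (\sum_a \sum_b `|(r *: jet_inv m - jet_inv J) a b|) * \tr J.1.1.2
  + `|r * jet_scal m - jet_scal J|.

Lemma jet_gap_refl J : 0 < \det J.1.1.2 -> jet_gap J J = 0.
Proof.
move=> dJ; rewrite /jet_gap /vol_ratio divff ?gt_eqF ?sqrtr_gt0//.
rewrite subrr normr0 mul1r subrr normr0 scale1r subrr big1 ?mul0r ?addr0//.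
by move=> a _; rewrite big1// => b _; rewrite mxE normr0.
Qed.

(** Both jets vary: when m moves in the jet bundle its base point moves, and with it the jet of g to
    which m is compared. *)
Lemma cvg_jet_gap (S : Type) (F : set_system S) (f g : S -> model) J m :
  Filter F -> f @ F --> J -> g @ F --> m ->
  0 < \det J.1.1.2 -> 0 < \det m.1.1.2 ->
  jet_gap (f x) (g x) @[x --> F] --> jet_gap J m.
Proof.
move=> FF fJ gm dJ dm.
have [_ f1 _ _] := cvg_jet FF fJ; have [_ g1 _ _] := cvg_jet FF gm.
have r_ : vol_ratio (f x).1.1.2 (g x).1.1.2 @[x --> F] -->
    vol_ratio J.1.1.2 m.1.1.2.
  apply: cvgM.
    by apply: continuous_cvg; [exact: sqrt_continuous|exact: cvg_det].
  apply: cvgV; first by rewrite gt_eqF// sqrtr_gt0.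
  by apply: continuous_cvg; [exact: sqrt_continuous|exact: cvg_det].
have /(@cvg_mxP R) iJ : jet_inv (f x) @[x --> F] --> jet_inv J.
  by apply: cvg_jet_inv => //; rewrite gt_eqF.
have /(@cvg_mxP R) im : jet_inv (g x) @[x --> F] --> jet_inv m.
  by apply: cvg_jet_inv => //; rewrite gt_eqF.
have sJ : jet_scal (f x) @[x --> F] --> jet_scal J.
  by apply: cvg_jet_scal => //; rewrite gt_eqF.
have sm : jet_scal (g x) @[x --> F] --> jet_scal m.
  by apply: cvg_jet_scal => //; rewrite gt_eqF.
apply: cvgD; [apply: cvgD|].
- by apply: cvg_norm; apply: cvgB => //; exact: cvg_cst.
- apply: cvgM; last exact: cvg_mxtrace.
  apply: cvg_bigsum => a _; apply: cvg_bigsum => b _; apply: cvg_norm.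
  rewrite !mxE; under eq_fun do rewrite !mxE.
  by apply: cvgB; [apply: cvgM|exact: iJ]; [exact: r_|exact: im].
- by apply: cvg_norm; apply: cvgB => //; exact: cvgM.
Qed.

(** The gap is a sum of three nonnegative terms, each thus below e; [qf_le_tr] turns the middle one
    into the estimate for covectors. *)
Lemma jet_gapP G H x (e : R) : posdef (G x) -> posdef (H x) ->
  jet_gap (jet_of G x) (jet_of H x) < e ->
  let r := vol_ratio (G x) (H x) in
  [/\ `|r - 1| <= e,
      forall u, `|r * qf (invmx (H x)) u - qf (invmx (G x)) u|
                <= e * qf (invmx (G x)) u &
      `|r * jet_scal (jet_of H x) - jet_scal (jet_of G x)| <= e].
Proof.
move=> pG pH; rewrite /jet_gap /=.
set r := vol_ratio _ _; set Q := \sum_a _.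
have Q0 : 0 <= Q by apply: sumr_ge0 => a _; apply: sumr_ge0.
have tG : 0 <= \tr (G x) by apply: sumr_ge0 => a _; exact/ltW/posdef_diag.
have QG : 0 <= Q * \tr (G x) by exact: mulr_ge0.
move=> h.
have := normr_ge0 (r - 1).
have := normr_ge0 (r * jet_scal (jet_of H x) - jet_scal (jet_of G x)).
move=> h1 h2; split; try lra.
move=> u; have := qf_le_tr (r *: invmx (H x) - invmx (G x)) u pG.
rewrite qfDl qfZl qfNl => /le_trans; apply.
by rewrite ler_wpM2r ?posdef_ge0//; [exact: posdef_inv|rewrite -/Q; lra].
Qed.

End jet_gap.

(** * Metrics in charts and a fine neighborhood *)

Section metric_charts.
Context {R : realType} {n : nat} (M : smooth_manifold R n).
Implicit Types (i : cidx M) (p : M) (g h : metric M).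

Definition img i : set 'rV[R]_n := crd i @` dom i.

Definition loc g i : 'rV[R]_n -> 'M[R]_n := fun x => g i (par i x).

Lemma open_img i : open (img i).
Proof. exact: open_cimg. Qed.

Lemma open_dom i : open (dom i).
Proof. exact: open_cdom. Qed.

Lemma parK i p : dom i p -> par i (crd i p) = p.
Proof. exact: cmapK. Qed.

Lemma crd_continuous i p : dom i p -> {for p, continuous (crd i)}.
Proof.
move=> ip; have := @cmap_continuous _ _ _ (charts i).
by move/(open_within_continuousP _ (@open_dom i)); apply.
Qed.

Lemma dom_par i x : img i x -> dom i (par i x).
Proof. by move=> [p ip <-]; rewrite parK. Qed.

Lemma metric_posdef g i p : dom i p -> posdef (g i p).
Proof.
move=> ip; have Tip : ([set: M] `&` dom i) p by [].
have [_ sg pg _ _] := metricP g.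
by split; [exact: sg Tip|exact: pg Tip].
Qed.

Lemma loc_posdef g i x : img i x -> posdef (loc g i x).
Proof. by move=> /dom_par; exact: metric_posdef. Qed.

Lemma smooth_loc g i a b : smooth_on (img i) (fun x => loc g i x a b).
Proof. by have := metric_smooth (metricP g) i a b; rewrite setTI. Qed.

Lemma loc_det_gt0 g i x : img i x -> 0 < \det (loc g i x).
Proof. by move=> /(loc_posdef g)/posdef_det_gt0. Qed.

Lemma loc_det_neq0 g i x : img i x -> \det (loc g i x) != 0.
Proof. by move=> /(loc_det_gt0 g) ?; rewrite gt_eqF. Qed.

Lemma jet_of_loc_continuous g i x : img i x -> {for x, continuous (jet_of (loc g i))}.
Proof. by move=> ix; apply: jet_of_continuous ix; [exact: open_img|exact: smooth_loc]. Qed.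

(** [jet2_crd] reads a chosen representative h of the class. As h lies in its own class, which is
    that of g, its coordinates agree with those of g. *)
Lemma jet2_crd_j2 g i p : dom i p ->
  jet2_crd i (j2 g p) = jet_of (loc g i) (crd i p).
Proof.
move=> ip; rewrite /jet2_crd /jet_rep; case: cid2 => h /= hp E.
have : jet_class p h h := conj hp (fun _ _ => erefl).
by rewrite -E => -[_ /(_ i ip) <-]; rewrite /jet_of /loc parK.
Qed.

Lemma open_jet2_subbase (V : set (jet2 M)) : jet2_subbase V -> open V.
Proof.
move=> VB; exists [set V]; last by rewrite bigcup_set1.
by move=> _ ->; exact: finI_from1 VB.
Qed.

Lemma jet2_crd_pt i (J : jet2 M) : (jet2_crd i J).1.1.1 = crd i (jet_pt J).
Proof. by []. Qed.

(** Continuity of the projection of the jet bundle to M: in a bundle chart it is the first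
    component. *)
Lemma open_jet_pt (O : set M) : open O -> open [set J : jet2 M | O (jet_pt J)].
Proof.
move=> oO; have -> : [set J : jet2 M | O (jet_pt J)] = \bigcup_i
    (jet2_dom i `&` jet2_crd i @^-1` [set m | (crd i @` (O `&` dom i)) m.1.1.1]).
  apply/seteqP; split => J /=.
    move=> OJ; have [i iJ] := charts_cover (jet_pt J).
    by exists i => //; split=> //; exists (jet_pt J).
  move=> [i _ [iJ [p [Op ip]]]]; rewrite jet2_crd_pt => pJ.
  by rewrite -(parK iJ) -pJ parK.
apply: bigcup_open => i _; apply: open_jet2_subbase; exists i,
  [set m | (crd i @` (O `&` dom i)) m.1.1.1].
split=> //; rewrite crd_image.
apply: (open_comp (f := fun m : jet_model => m.1.1.1)) => [m _|].
  by have [] := cvg_jet (nbhs_filter m) (@cvg_id _ _).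
by apply: within_open_preimage => //; [exact: open_img|exact: cinv_continuous].
Qed.

(** A positive determinant is an open condition and all that the continuity of [jet_gap] asks of
    m. *)
Definition close_jets g i (e : R) : set (@jet_model R n) :=
  [set m | [/\ img i m.1.1.1, 0 < \det m.1.1.2 &
               jet_gap (jet_of (loc g i) m.1.1.1) m < e]].

Lemma open_close_jets g i e : open (close_jets g i e).
Proof.
rewrite openE => m [im dm gm].
have c1 : m'.1.1.1 @[m' --> m] --> m.1.1.1.
  by have [] := cvg_jet (nbhs_filter m) (@cvg_id _ _).
have c2 : m'.1.1.2 @[m' --> m] --> m.1.1.2.
  by have [] := cvg_jet (nbhs_filter m) (@cvg_id _ _).
have n1 : \forall m' \near m, img i m'.1.1.1.
  by apply: (c1 (img i)); apply: open_nbhs_nbhs; split => //; exact: open_img.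
have n2 : \forall m' \near m, 0 < \det m'.1.1.2.
  have d2 := @cvg_det _ _ _ (nbhs_filter m) _ _ _ c2.
  apply: (d2 [set y | 0 < y]); by apply: open_nbhs_nbhs; split=> //; exact: open_gt.
have gap_ : jet_gap (jet_of (loc g i) m'.1.1.1) m' @[m' --> m] -->
    jet_gap (jet_of (loc g i) m.1.1.1) m.
  apply: (cvg_jet_gap (nbhs_filter m)) => //; last exact: loc_det_gt0.
  have cJ := @jet_of_loc_continuous g _ _ im.
  exact: (cvg_comp _ _ c1 cJ).
have n3 : \forall m' \near m, jet_gap (jet_of (loc g i) m'.1.1.1) m' < e.
  apply: (gap_ [set y | y < e]).
  by apply: open_nbhs_nbhs; split=> //; exact: open_lt.
by apply: filterS (filterI n1 (filterI n2 n3)) => m' [? [? ?]].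
Qed.

Local Notation idx := (cover_idx (the_cover M)).

(* Closed sets D k containing the cells; they are locally finite because the
   interior of the k-th set of the cover misses D l for all l > k. *)
Definition closed_cell k : set M :=
  cover_set (the_cover M) k `\` \bigcup_(j < k) (cover_set (the_cover M) j)°.

Lemma closed_closed_cell k : closed (closed_cell k).
Proof.
rewrite /closed_cell setDE; apply: closedI.
  apply: compact_closed; first exact: carrier_hausdorff.
  exact: Defs.cover_compact.
by apply: open_closedC; apply: bigcup_open => j _; exact: open_interior.
Qed.

Lemma cell_closed_cell k : cell k `<=` @closed_cell k.
Proof.
rewrite /cell /seqDU => p [Kp nK]; split=> // -[j jk jp]; apply: nK.
by rewrite -bigcup_mkord; exists j => //; exact: interior_subset.
Qed.

Lemma cell_dom k p : cell k p -> dom (idx k) p.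
Proof. by move=> [Kp _]; exact: cover_sub Kp. Qed.

(** The k-th condition is imposed only on jets over the k-th closed cell; closedness makes the set
    of unconstrained jets open. By local finiteness the intersection of all conditions is open,
    although the [e k] may tend to 0. *)
Lemma fine_nbhd g (e : nat -> R) : (forall k, 0 < e k) ->
  exists U : set (jet2 M), [/\ open U, graph_j2 g `<=` U &
    forall h, graph_j2 h `<=` U -> forall k p, cell k p ->
      jet_gap (jet_of (loc g (idx k)) (crd (idx k) p))
              (jet_of (loc h (idx k)) (crd (idx k) p)) < e k].
Proof.
move=> e0.
pose V k : set (jet2 M) := jet2_dom (idx k) `&` jet2_crd (idx k) @^-1` close_jets g (idx k) (e k).
have oV k : open (V k).
  apply: open_jet2_subbase; exists (idx k), (close_jets g (idx k) (e k)).
  by split=> //; exact: open_close_jets.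
pose U k := V k `|` [set J | ~ closed_cell k (jet_pt J)].
have oU k : open (U k).
  apply: openU => //; apply: (@open_jet_pt (~` closed_cell k)).
  exact/closed_openC/closed_closed_cell.
exists (\bigcap_k U k); split.
- rewrite openE => J UJ.
  have : (\bigcup_k (cover_set (the_cover M) k)°) (jet_pt J) by rewrite cover_interior.
  move=> [k _ kJ].
  have N1 : nbhs J [set J | (cover_set (the_cover M) k)° (jet_pt J)].
    by apply: open_nbhs_nbhs; split=> //; apply: open_jet_pt; exact: open_interior.
  have N2 m : nbhs J [set J' | forall l, (l < m)%N -> U l J'].
    elim: m => [|m IH]; first by apply: filterE => J' l.
    have Um : nbhs J (U m) by apply: open_nbhs_nbhs; split=> //; exact: UJ.
    apply: filterS2 IH Um => J' J'm J'U l.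
    by rewrite ltnS leq_eqVlt => /predU1P[->|/J'm].
  apply: filterS2 N1 (N2 k.+1) => J' J'1 J'2 l _.
  (* Near a jet over the interior of the k-th set of the cover, the conditions with l > k hold
     vacuously. *)
  have [lk|kl] := leqP l k; first by exact: J'2.
  right=> /= -[_]; apply; exists k => //.
- move=> _ [p _ <-] k _.
  have [kp|] := pselect (closed_cell k p); last by right.
  left; have ip : dom (idx k) p by case: kp => /cover_sub.
  split=> //=; rewrite jet2_crd_j2//.
  have im : img (idx k) (crd (idx k) p) by exists p.
  split=> //=; first exact: loc_det_gt0.
  by rewrite jet_gap_refl ?e0//; exact: loc_det_gt0.
- move=> h hU k p kp.
  have ip := cell_dom kp.
  have [|[_]|] := hU (j2 h p) _ k I; first by exists p.
    by rewrite /= jet2_crd_j2// => -[].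
  by case; exact: cell_closed_cell.
Qed.

End metric_charts.

(** * Integration against the image of a measure with density *)

Section integral_of_density.
Local Open Scope ereal_scope.
Context d1 d2 (X : measurableType d1) (Y : measurableType d2) (R : realType).
Variables (lam : {measure set X -> \bar R}) (nu : {measure set Y -> \bar R}).
Variables (D : set X) (phi : X -> Y) (rho : X -> R).
Hypotheses (mD : measurable D) (mphi : measurable_fun D phi)
  (mrho : measurable_fun D rho) (rho0 : forall x, (0 <= rho x)%R).
Hypothesis nuE : forall A, measurable A ->
  nu A = \int[lam]_(x in D `&` phi @^-1` A) (rho x)%:E.

Import HBNNSimple.

Let integral_density_nnsfun (f : {nnsfun Y >-> R}) :
  \int[nu]_y (f y)%:E = \int[lam]_(x in D) ((f (phi x))%:E * (rho x)%:E).
Proof.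
rewrite integralT_nnsfun sintegralE.
have mphif r : measurable (D `&` phi @^-1` (f @^-1` [set r])) by exact: mphi.
transitivity (\int[lam]_(x in D) \sum_(r \in range f)
    (r * \1_(phi @^-1` (f @^-1` [set r])) x * rho x)%:E); last first.
  apply: eq_integral => x _; rewrite [in RHS]fimfunE.
  by rewrite fsumEFin// -EFinM mulr_fsuml.
have term r x : ((r * \1_(phi @^-1` (f @^-1` [set r])) x * rho x)%:E =
    r%:E * (rho x * \1_(phi @^-1` (f @^-1` [set r])) x)%:E).
  by rewrite -EFinM mulrAC mulrA.
have mind r : measurable_fun D (\1_(phi @^-1` (f @^-1` [set r])) : X -> R).
  rewrite (_ : \1_(_) = (\1_(f @^-1` [set r]) : Y -> R) \o phi)//.
  by apply: measurableT_comp.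
have mterm r : measurable_fun D (fun x => (rho x * \1_(phi @^-1` (f @^-1` [set r])) x)%:E).
  by apply/measurable_EFinP/measurable_funM.
have term0 r x : 0 <= r%:E * (rho x * \1_(phi @^-1` (f @^-1` [set r])) x)%:E.
  rewrite indicE; case: (boolP (_ \in _)) => [|_]; last by rewrite mulr0 mule0.
  by rewrite inE /= => <-; rewrite mulr1 -EFinM lee_fin mulr_ge0.
under eq_integral do under eq_fsbigr do rewrite term.
rewrite ge0_integral_fsum//; last by move=> r; exact: measurable_funeM.
apply: eq_fsbigr => r /set_mem[y _ <-]; rewrite nuE//.
rewrite ge0_integralZl_EFin//; last by move=> x _; rewrite lee_fin mulr_ge0// indicE.
congr (_ * _).
rewrite integral_mkcondr; apply: eq_integral => x _.
rewrite /patch indicE; case: ifPn => _; first by rewrite mulr1.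
by rewrite mulr0.
Qed.

(** Passage from simple functions to f by monotone convergence on both sides, the factor [rho] being
    nonnegative. *)
Lemma ge0_integral_density (f : Y -> \bar R) :
  measurable_fun setT f -> (forall y, 0 <= f y) ->
  \int[nu]_y f y = \int[lam]_(x in D) (f (phi x) * (rho x)%:E).
Proof.
move=> mf f0; pose f_ := nnsfun_approx measurableT mf.
have f_f y : (fun n => (f_ n y)%:E) @ \oo --> f y by exact: cvg_nnsfun_approx.
transitivity (limn (fun n => \int[nu]_y (f_ n y)%:E)).
  rewrite -monotone_convergence//.
  - by apply: eq_integral => y _; apply/esym/cvg_lim.
  - by move=> n; exact/measurable_EFinP/measurable_funP.
  - by move=> n y _; rewrite lee_fin.
  - by move=> y _ m n mn; rewrite lee_fin; exact/lefP/nd_nnsfun_approx.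
under eq_fun do rewrite integral_density_nnsfun.
rewrite -monotone_convergence//.
- apply: eq_integral => x _; apply/cvg_lim => //.
  exact: cvgeZr.
- move=> n; apply: emeasurable_funM; last exact/measurable_EFinP.
  apply/measurable_EFinP; apply: measurableT_comp => //.
- by move=> n x _; rewrite mule_ge0 ?lee_fin.
- move=> x _ m n mn; rewrite lee_wpmul2r ?lee_fin//.
  exact/lefP/nd_nnsfun_approx.
Qed.

End integral_of_density.

(** * Finite Lebesgue measure of boxes *)

Section lebesgue_boxes.
Context {R : realType}.
Local Notation Rn n := (n.-tuple (measurableTypeR R)).

Definition box n (r : R) : set (Rn n) := [set t | forall i, `|tnth t i| <= r].

Lemma measurable_box n r : measurable (@box n r).
Proof.
rewrite (_ : box r = \bigcap_(i in [set: 'I_n])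
    ((fun t : Rn n => tnth t i) @^-1` `[- r, r])).
  apply: fin_bigcap_measurable => [|i _]; first exact: finite_finset.
  rewrite -[X in measurable X]setTI.
  by apply: measurable_tnth => //; exact: measurable_itv.
apply/seteqP; split => t /=.
  by move=> bt i _ /=; have := bt i; rewrite in_itv /= ler_norml.
by move=> bt i; have := bt i I; rewrite /= in_itv /= ler_norml.
Qed.

Lemma lebesgue_box_lty n r : (lebesgue_Rn n (@box n r) < +oo)%E.
Proof.
elim: n => [|n IH] /=.
  by rewrite diracE; case: (_ \in _); rewrite ltry.
rewrite /lebesgue_cons /pushforward.
have -> : @tcons R n @^-1` box r = `[- r, r]%classic `*` box r.
  apply/seteqP; split => [[x t] /= bt|[x t] /= [xr bt] i].
    split; first by have := bt ord0; rewrite tnth0 in_itv/= ler_norml.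
    by move=> i; have := bt (lift ord0 i); rewrite tnthS.
  case: (unliftP ord0 i) => [j ->|->]; first by rewrite tnthS; exact: bt.
  by rewrite tnth0; move: xr; rewrite /= in_itv/= ler_norml.
rewrite product_measure1E//; last exact: measurable_box.
have l : @lebesgue_measure R `[(- r)%R, r%R]%classic \is a fin_num.
  by rewrite lebesgue_measure_itv/=; case: ifPn.
exact: lte_mul_pinfty.
Qed.

End lebesgue_boxes.

Lemma continuous_sqrt_det (R : realType) (T : topologicalType) n
    (G : T -> 'M[R]_n) x : {for x, continuous G} ->
  {for x, continuous (fun y => Num.sqrt (\det (G y)))}.
Proof.
move=> cG; apply: continuous_cvg; first exact: sqrt_continuous.
exact: cvg_det.
Qed.

(** * Functions continuous on each cell *)

Section cellwise.
Context {R : realType} {n : nat} (M : smooth_manifold R n).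
Implicit Types (f : M -> R) (p : M).
Local Notation idx := (cover_idx (the_cover M)).

(* Quantities defined through chart_at may jump from one cell to the next. *)
Definition cellwise f : Prop := forall k, exists F : 'rV[R]_n -> R,
  (forall x, img (idx k) x -> {for x, continuous F}) /\
  (forall p, cell k p -> f p = F (crd (idx k) p)).

Lemma chart_atE k p : cell k p -> chart_at p = idx k.
Proof.
move=> kp; rewrite /chart_at; case: cid => l /= lp; congr (idx _).
by apply: (@trivIset_seqDU _ (cover_set (the_cover M))) => //; exists p.
Qed.

Lemma cellwise_chart f (F : cidx M -> 'rV[R]_n -> R) :
  (forall i x, img i x -> {for x, continuous (F i)}) ->
  (forall p, f p = F (chart_at p) (crd (chart_at p) p)) -> cellwise f.
Proof.
move=> cF fF k; exists (F (idx k)); split; first exact: cF.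
by move=> p kp; rewrite fF (chart_atE kp).
Qed.

Lemma cellwise_cst c : cellwise (fun=> c).
Proof. by apply: (@cellwise_chart _ (fun _ _ => c)) => // i x _; exact: cst_continuous. Qed.

Lemma loc_continuous (g : metric M) i x : img i x -> {for x, continuous (loc g i)}.
Proof.
move=> ix; apply/continuous_mxP => a b.
by apply: smooth_on_continuous_at ix; [exact: open_img|exact: smooth_loc].
Qed.

Lemma cellwise_add f g : cellwise f -> cellwise g -> cellwise (fun p => f p + g p).
Proof.
move=> cf cg k; have [F [cF fF]] := cf k; have [G [cG gG]] := cg k.
exists (fun x => F x + G x); split.
  by move=> x ix; exact: (continuousD (cF x ix) (cG x ix)).
by move=> p kp; rewrite fF// gG.
Qed.

Lemma cellwise_mul f g : cellwise f -> cellwise g -> cellwise (fun p => f p * g p).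
Proof.
move=> cf cg k; have [F [cF fF]] := cf k; have [G [cG gG]] := cg k.
exists (fun x => F x * G x); split.
  by move=> x ix; exact: (continuousM (cF x ix) (cG x ix)).
by move=> p kp; rewrite fF// gG.
Qed.

Lemma cellwise_norm f : cellwise f -> cellwise (fun p => `|f p|).
Proof.
move=> cf k; have [F [cF fF]] := cf k.
exists (fun x => `|F x|); split; last by move=> p kp; rewrite fF.
by move=> x ix; exact: (cvg_norm (cF x ix)).
Qed.

Lemma cellwise_sqr f : cellwise f -> cellwise (fun p => f p ^+ 2).
Proof. by move=> cf; exact: cellwise_mul. Qed.

Lemma cellwise_smooth v : smooth v -> @cellwise v.
Proof.
move=> sv; apply: (@cellwise_chart _ (fun i => v \o par i)).
  by move=> i x ix; apply: smooth_on_continuous_at (sv i) ix; exact: open_img.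
by move=> p /=; rewrite parK//; exact: chart_atP.
Qed.

Lemma cellwise_comp_continuous f k (F : 'rV[R]_n -> R) p :
  (forall x, img (idx k) x -> {for x, continuous F}) ->
  dom (idx k) p -> {for p, continuous (F \o crd (idx k))}.
Proof.
move=> cF kp; apply: continuous_comp; first exact: crd_continuous.
by apply: cF; exists p.
Qed.

Lemma bigcup_cell : \bigcup_k @cell _ _ M k = setT.
Proof. by apply/seteqP; split=> // p _; have [k kp] := ex_cell p; exists k. Qed.

(** The cells form a countable Borel partition, so measurability may be tested on each of them. *)
Lemma cellwise_measurable f : cellwise f ->
  measurable_fun setT (f : @borel R n M -> R).
Proof.
move=> cf; rewrite -bigcup_cell.
apply/(measurable_fun_bigcup (T1 := @borel R n M)) => k; first exact: measurable_cell.
have [F [cF fF]] := cf k.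
move=> mk; apply: (measurability _ (RGenOpens.measurableE R)) => //.
move=> _ [_ [x [y ->]] <-].
have -> : cell k `&` f @^-1` `]x, y[ =
    cell k `&` (dom (idx k) `&` (F \o crd (idx k)) @^-1` `]x, y[).
  apply/seteqP; split => p [kp /=]; rewrite (fF _ kp).
    by move=> h; split=> //; split=> //; exact: cell_dom.
  by move=> [_ h].
apply: measurableI => //; apply: sub_sigma_algebra.
apply: within_open_preimage; [exact: open_dom| |exact: interval_open].
by apply/open_within_continuousP => [|p kp]; [exact: open_dom|exact: cellwise_comp_continuous].
Qed.

(** The representing function is continuous on the whole chart image, hence attains a maximum over
    the compact set that contains the cell. *)
Lemma cellwise_bounded f k : cellwise f ->
  exists2 C, 0 <= C & forall p, cell k p -> `|f p| <= C.
Proof.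
move=> /cellwise_norm cf; have [F [cF fF]] := cf k.
have [[p0 kp0]|no] := pselect (exists p0, cell (M := M) k p0); last first.
  by exists 0 => // p kp; exfalso; apply: no; exists p.
have [p1 _ p1P] : exists2 c : M, c \in cover_set (the_cover M) k &
    forall t, t \in cover_set (the_cover M) k ->
      (F \o crd (idx k)) t <= (F \o crd (idx k)) c.
  apply: compact_EVT_max; [by exists p0; case: kp0|exact: Defs.cover_compact|].
  apply: (continuous_subspaceW (@cover_sub _ _ _ (the_cover M) k)).
  by apply/open_within_continuousP => [|p kp]; [exact: open_dom|exact: cellwise_comp_continuous].
exists (F (crd (idx k) p1)).
  rewrite (le_trans _ (p1P p0 _)) ?inE//; last by case: kp0.
  by rewrite /= -(fF _ kp0).
by move=> p kp; rewrite (fF p kp); apply: p1P; rewrite inE; case: kp.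
Qed.

End cellwise.

(** * Integrals over abstract measure spaces *)

Section abstract_integrals.
Local Open Scope ereal_scope.
Context d (Y : measurableType d) (R : realType).

(** Multiplication by [rho] >= 0 commutes with positive and negative parts, so the formula extends
    to signed f without any integrability. *)
Lemma integral_change_density (nu1 nu2 : {measure set Y -> \bar R}) (rho : Y -> R) :
  (forall y, (0 <= rho y)%R) ->
  (forall f : Y -> \bar R, measurable_fun setT f -> (forall y, 0 <= f y) ->
     \int[nu2]_y f y = \int[nu1]_y (f y * (rho y)%:E)) ->
  forall f : Y -> R, measurable_fun setT f ->
    \int[nu2]_y (f y)%:E = \int[nu1]_y (f y * rho y)%:E.
Proof.
move=> rho0 H f mf; rewrite integralE [RHS]integralE.
have mE : measurable_fun setT (fun y => (f y)%:E) by exact/measurable_EFinP.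
rewrite (H _ (measurable_funepos mE))// (H _ (measurable_funeneg mE))//.
congr (_ - _); apply: eq_integral => y _.
  rewrite !funeposE -!EFin_max -EFinM; congr EFin.
  by rewrite maxr_pMl// mul0r.
rewrite !funenegE -!EFinN -!EFin_max -EFinM; congr EFin.
by rewrite maxr_pMl// mul0r mulNr.
Qed.

Lemma integrable_bounded_support (mu : {measure set Y -> \bar R}) (E : set Y)
    (C : R) (f : Y -> R) :
  measurable E -> mu E < +oo -> measurable_fun setT f ->
  (forall y, `|f y| <= C * \1_E y)%R -> mu.-integrable setT (EFin \o f).
Proof.
move=> mE muE mf fC.
have mI : measurable_fun setT (fun y => (C * \1_E y)%:E).
  by apply/measurable_EFinP/measurable_funM => //; exact: measurable_indic.
apply: (le_integrable measurableT (g := fun y => (C * \1_E y)%:E)).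
- exact/measurable_EFinP.
- by move=> y _ /=; rewrite lee_fin (le_trans (fC y))// ler_norm.
apply/integrableP; split => //.
under eq_integral do rewrite /= normrM [X in (_ * X)%R]ger0_norm ?indicE// -indicE EFinM.
rewrite ge0_integralZl_EFin//; last exact/measurable_EFinP/measurable_indic.
by rewrite integral_indic// setIT lte_mul_pinfty.
Qed.

Lemma measure_bigcup_ltn_lty (mu : {measure set Y -> \bar R}) (E : nat -> set Y) N :
  (forall k, measurable (E k)) -> (forall k, mu (E k) < +oo) ->
  mu (\bigcup_(k < N) E k) < +oo.
Proof.
move=> mE muE; rewrite bigcup_mkord; elim: N => [|m IH].
  by rewrite big_ord0 measure0.
rewrite big_ord_recr/=; apply: le_lt_trans (measureU2 _ _ _) _ => //.
  by apply: bigsetU_measurable.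
by apply: lte_add_pinfty; [exact: IH|exact: muE].
Qed.

End abstract_integrals.

(** * The Riemannian measure and its dependence on the metric *)

Section riemannian_integral.
Context {R : realType} {n : nat} (M : smooth_manifold R n).
Implicit Types (g h : metric M) (p : M).
Local Notation idx := (cover_idx (the_cover M)).
Local Notation rowt := (@row_of_tuple R n).
Local Notation mu := (@riemannian_measure R n M).
Local Notation bM := (@borel R n M).

Definition cell_img k : set (n.-tuple (measurableTypeR R)) :=
  rowt @^-1` (crd (idx k) @` (cell k `&` dom (idx k))).

Lemma measurable_cell_img k : measurable (cell_img k).
Proof. by apply: (@measurable_crd R n M (idx k) (cell k)); exact: measurable_cell. Qed.

Lemma cell_img_dom k : cell_img k `<=` rowt @^-1` (crd (idx k) @` dom (idx k)).
Proof. by move=> t [p [_ ip] pt]; exists p. Qed.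

Local Open Scope ereal_scope.

Lemma ge0_integral_riemannian g (f : bM -> \bar R) :
  measurable_fun setT f -> (forall p, 0 <= f p) ->
  \int[mu g]_p f p = \sum_(k <oo) \int[lebesgue_Rn n]_(t in cell_img k)
    (f (par (idx k) (rowt t)) * (density g (idx k) t)%:E).
Proof.
move=> mf f0; rewrite ge0_integral_measure_series//.
apply: eq_eseriesr => k _.
apply: (ge0_integral_density (phi := fun t => par (idx k) (rowt t) : bM)) => //.
- exact: measurable_cell_img.
- apply: measurable_funS (measurable_par (i := idx k)); last exact: cell_img_dom.
  exact: measurable_crd_dom.
- apply: measurable_funS (measurable_density g (i := idx k)); last exact: cell_img_dom.
  exact: measurable_crd_dom.
- by move=> t; exact: sqrtr_ge0.
move=> A mA; rewrite /mrestr/= /chart_volume; congr (integral _ _ _).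
apply/seteqP; split => t.
  move=> [p [[Ap kp] ip] pt]; split; first by exists p.
  by rewrite /preimage/= -pt parK.
by move=> [[p [kp ip] pt]]; rewrite /preimage/= -pt parK// => Ap; exists p.
Qed.

(** The density is bounded on the cell, and the chart maps the cell into a box. *)
Lemma riemannian_cell_lty g k : mu g (cell k) < +oo.
Proof.
rewrite -[cell k]setIT -(integral_indic (mu g) measurableT (measurable_cell k)).
rewrite ge0_integral_riemannian//; last first.
  apply/(@measurable_EFinP _ bM); apply: (@measurable_indic _ bM).
  exact: measurable_cell.
rewrite (nneseriesD1 (n := k))//; last first.
  by move=> l _; apply: integral_ge0 => t _; rewrite mule_ge0// lee_fin// sqrtr_ge0.
(* The cells are disjoint, so the terms other than the k-th vanish. *)
rewrite eseries0 ?adde0; last first.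
  move=> l _ /eqP lk; apply: integral0_eq => t [p [lp ip] pt].
  rewrite -pt parK// indicE memNset ?mul0e// => kp; apply: lk.
  by apply: (@trivIset_seqDU _ (cover_set (the_cover M))) => //; exists p.
have [C C0 dC] : exists2 C, (0 <= C)%R & forall p, cell k p ->
    (`|Num.sqrt (\det (g (chart_at p) p))| <= C)%R.
  apply: cellwise_bounded.
  apply: (@cellwise_chart _ _ _ _ (fun i x => Num.sqrt (\det (loc g i x)))).
    by move=> i x ix; apply: continuous_sqrt_det; exact: loc_continuous.
  by move=> p; rewrite /loc parK//; exact: chart_atP.
have [r rP] : exists r, cell_img k `<=` @box R n r.
  have cC : compact (crd (idx k) @` cover_set (the_cover M) k).
    apply: continuous_compact; last exact: Defs.cover_compact.
    apply: (continuous_subspaceW (@cover_sub _ _ _ (the_cover M) k)).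
    exact: cmap_continuous.
  have [N [_ /(_ (N + 1)%R)]] := compact_bounded cC.
  rewrite ltrDl ltr01 => /(_ erefl) NP; exists (N + 1)%R => t [p [kp ip] pt] i.
  have : (`|rowt t| <= N + 1)%R by apply: NP; exists p => //; case: kp.
  apply: le_trans; rewrite -[`|rowt t|%R]/(mx_norm (rowt t)) mx_normrE.
  apply: (bigmax_sup (ord0, i)) => //=.
  by rewrite mxE.
apply: (@le_lt_trans _ _ (\int[lebesgue_Rn n]_(t in cell_img k) (C%:E))).
  apply: ge0_le_integral => //.
  - exact: measurable_cell_img.
  - by move=> t _; rewrite mule_ge0// lee_fin// sqrtr_ge0.
  - apply: emeasurable_funM; last first.
      apply/measurable_EFinP; apply: measurable_funS (measurable_density g (i := idx k)).
        exact: measurable_crd_dom.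
      exact: cell_img_dom.
    apply/measurable_EFinP.
    have mI : measurable_fun setT (\1_(cell k) : bM -> R).
      by apply: (@measurable_indic _ bM); exact: measurable_cell.
    apply: (measurableT_comp mI).
    apply: measurable_funS (measurable_par (i := idx k)); last exact: cell_img_dom.
    exact: measurable_crd_dom.
  - move=> t [p [kp ip] pt]; rewrite /density -pt parK//.
    rewrite -EFinM lee_fin indicE mem_set// mul1r.
    by have := dC p kp; rewrite (chart_atE kp) ger0_norm// sqrtr_ge0.
rewrite integral_cst; last exact: measurable_cell_img.
apply: lte_mul_pinfty => //.
apply: le_lt_trans (lebesgue_box_lty n r).
apply: le_measure => //; rewrite inE; [exact: measurable_cell_img|exact: measurable_box].
Qed.

(** The Radon-Nikodym derivative of [mu h] with respect to [mu g]. *)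
Definition ratio g h p : R := vol_ratio (g (chart_at p) p) (h (chart_at p) p).

Lemma cellwise_ratio g h : cellwise (ratio g h).
Proof.
apply: (@cellwise_chart _ _ _ _ (fun i x => vol_ratio (loc g i x) (loc h i x))).
  have cs (f : metric M) i x : img i x ->
      {for x, continuous (fun x => Num.sqrt (\det (loc f i x)))}.
    by move=> ix; apply: continuous_sqrt_det; exact: loc_continuous.
  move=> i x ix; have d0 : (Num.sqrt (\det (loc g i x)) != 0)%R.
    by rewrite gt_eqF// sqrtr_gt0 loc_det_gt0.
  have ci := @continuousV R _ (fun y => Num.sqrt (\det (loc g i y))) x d0 (cs g i x ix).
  exact: (continuousM (cs h i x ix) ci).
by move=> p; rewrite /loc parK//; exact: chart_atP.
Qed.

Lemma ratio_ge0 g h p : (0 <= ratio g h p)%R.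
Proof. by rewrite divr_ge0// sqrtr_ge0. Qed.

Lemma ge0_integral_ratio g h (f : bM -> \bar R) :
  measurable_fun setT f -> (forall p, 0 <= f p) ->
  \int[mu h]_p f p = \int[mu g]_p (f p * (ratio g h p)%:E).
Proof.
move=> mf f0.
have mr : measurable_fun setT (ratio g h : bM -> R).
  by apply: cellwise_measurable; exact: cellwise_ratio.
have mfr : measurable_fun setT (fun p : bM => f p * (ratio g h p)%:E).
  by apply: emeasurable_funM => //; exact/(@measurable_EFinP _ bM).
have fr0 p : 0 <= f p * (ratio g h p)%:E by rewrite mule_ge0// lee_fin ratio_ge0.
apply: (etrans (ge0_integral_riemannian h mf f0)); apply/esym.
apply: (etrans (ge0_integral_riemannian g mfr fr0)); apply/esym.
apply: eq_eseriesr => k _; apply: eq_integral => t /set_mem[p [kp ip] pt].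
rewrite /density -pt parK// -muleA -EFinM; congr (_ * _%:E).
rewrite /ratio (chart_atE kp) /vol_ratio mulfVK// gt_eqF// sqrtr_gt0.
exact/posdef_det_gt0/metric_posdef.
Qed.

Lemma integral_ratio g h (f : bM -> R) : measurable_fun setT f ->
  \int[mu h]_p (f p)%:E = \int[mu g]_p (f p * ratio g h p)%:E.
Proof.
apply: integral_change_density; first exact: ratio_ge0.
exact: ge0_integral_ratio.
Qed.

Lemma cellwise_integrable g (f : M -> R) N : cellwise f ->
  (forall p, (forall k, (k < N)%N -> ~ cell k p) -> f p = 0%R) ->
  (mu g).-integrable setT (EFin \o (f : bM -> R)).
Proof.
move=> cf f0.
have mE : measurable (\bigcup_(k < N) cell k : set bM).
  by apply: bigcup_measurable => k _; exact: measurable_cell.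
have [C C0 fC] : exists2 C, (0 <= C)%R & forall p, (\bigcup_(k < N) cell k) p -> (`|f p| <= C)%R.
  elim: N {f0 mE} => [|N [C C0 fC]]; first by exists 0%R => // p [].
  have [B B0 fB] := cellwise_bounded N cf.
  exists (C + B)%R; first exact: addr_ge0.
  move=> p [k /=]; rewrite ltnS leq_eqVlt => /predU1P[->|kN] kp.
    by rewrite (le_trans (fB p kp))// lerDr.
  by rewrite (le_trans (fC p _)) ?lerDl//; exists k.
apply: (@integrable_bounded_support _ bM _ _ (\bigcup_(k < N) cell k) C) => //.
- apply: (@measure_bigcup_ltn_lty _ bM) => k; first exact: measurable_cell.
  exact: riemannian_cell_lty.
- exact: cellwise_measurable.
- move=> p; rewrite indicE; case: (boolP (_ \in _)) => [/set_mem pN|].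
    by rewrite mulr1 fC.
  rewrite notin_setE => pN.
  by rewrite f0 ?normr0 ?mulr0// => k kN kp; apply: pN; exists k.
Qed.

End riemannian_integral.

(** * Smooth bump functions *)

Section bumps.
Context {R : realType} {n : nat} (M : smooth_manifold R n).
Implicit Types (i j : cidx M) (p q : M) (u v chi : M -> R).

Lemma smooth_cst (c : R) : @smooth R n M (fun=> c).
Proof. by move=> i k; exact: Ck_cst. Qed.

Lemma smooth_add u v : smooth u -> smooth v -> smooth (fun p => u p + v p).
Proof.
move=> su sv i k; apply: (@Ck_add _ _ _ _ (u \o par i) (v \o par i)).
- exact: open_img.
- exact: su.
- exact: sv.
Qed.

Lemma smooth_mul u v : smooth u -> smooth v -> smooth (fun p => u p * v p).
Proof.
move=> su sv i k; apply: (@Ck_mul _ _ _ _ (u \o par i) (v \o par i)).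
- exact: open_img.
- exact: su.
- exact: sv.
Qed.

Lemma smooth_continuous_on v : smooth v -> continuous (v : M -> R).
Proof.
move=> sv p; have [i ip] := charts_cover p.
have ii : img i (crd i p) by exists p.
have cv : {for crd i p, continuous (v \o par i)}.
  by apply: smooth_on_continuous_at (sv i) ii; exact: open_img.
have cc : {for p, continuous ((v \o par i) \o crd i)}.
  exact: continuous_comp (crd_continuous ip) cv.
have e : ((v \o par i) \o crd i) p = v p by rewrite /= parK.
rewrite /continuous_at -e; apply: cvg_trans cc; apply: near_eq_cvg.
apply: filterS (open_nbhs_nbhs (conj (@open_dom _ _ _ i) ip)) => q iq.
by rewrite /= parK.
Qed.

(** Unlike a test function it may vanish identically, which admits empty sums, and K is any compact
    set off which it vanishes. *)
Definition bump_function v : Prop := [/\ smooth v, forall p, 0 <= v p &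
  exists2 K : set M, compact K & forall p, ~ K p -> v p = 0].

Lemma bump0 : bump_function (fun=> 0).
Proof. by split=> //; [exact: smooth_cst|exists set0 => //; exact: compact0]. Qed.

Lemma bump_add u v : bump_function u -> bump_function v -> bump_function (fun p => u p + v p).
Proof.
move=> [su u0 [K cK uK]] [sv v0 [L cL vL]]; split.
- exact: smooth_add.
- by move=> p; exact: addr_ge0.
exists (K `|` L); first exact: compactU.
move=> p nKL; rewrite uK ?vL ?addr0// => ?; apply: nKL; [by right|by left].
Qed.

Lemma bump_mul u v : smooth u -> (forall p, 0 <= u p) -> bump_function v ->
  bump_function (fun p => u p * v p).
Proof.
move=> su u0 [sv v0 [L cL vL]]; split.
- exact: smooth_mul.
- by move=> p; exact: mulr_ge0.
by exists L => // p nL; rewrite vL ?mulr0.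
Qed.

Lemma bump_scale (c : R) v : 0 <= c -> bump_function v -> bump_function (fun p => c * v p).
Proof. by move=> c0; apply: bump_mul => //; exact: smooth_cst. Qed.

Lemma test_functionP v : test_function v <-> bump_function v /\ exists p, v p != 0.
Proof.
split=> [[sv cv v0 vp]|[[sv v0 [K cK vK]] vp]].
  split=> //; split=> //; exists (closure [set p | v p != 0]) => // p np.
  by apply/eqP; apply: contrapT => /negP vn0; apply: np; exact: subset_closure.
have clK : closed K by exact: compact_closed (@carrier_hausdorff _ _ M) cK.
split=> //; apply: subclosed_compact cK _; first exact: closed_closure.
rewrite [X in _ `<=` X](proj1 (closure_id _) clK).
apply: closureS => p vn0; apply: contrapT => /vK v00.
by move: vn0; rewrite /= v00 eqxx.
Qed.

(** In a chart around p, a product over the coordinates of flat functions of c^2 - (x_b - x0_b)^2.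
    It vanishes off a cube, which is a closed ball of the norm on row vectors. *)
Lemma chart_bump p : exists v, bump_function v /\ 0 < v p.
Proof.
have [i ip] := charts_cover p; set x0 := crd i p.
have ii : img i x0 by exists p.
have /nbhs_ballP[e /= e0 eD] : nbhs x0 (img i).
  by apply: open_nbhs_nbhs; split => //; exact: open_img.
pose c := e / 2; have c0 : 0 < c by rewrite divr_gt0.
have BD : closed_ball x0 c `<=` img i.
  apply: subset_trans eD; apply: closed_ball_subset => //.
  by rewrite [ltRHS]splitr ltrDl.
pose K := par i @` closed_ball x0 c.
have Ki : K `<=` dom i by move=> _ [x /BD ix <-]; exact: dom_par.
have cK : compact K.
  apply: continuous_compact.
    exact: continuous_subspaceW BD (@cinv_continuous _ _ _ _).
  apply: bounded_closed_compact; last exact: closed_ball_closed.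
  exists (`|x0| + c); split; first exact: num_real.
  move=> N eN y; rewrite closed_ballE// /closed_ball_ /= => ye.
  rewrite (le_trans _ (ltW eN))// -[y in leLHS](subKr x0).
  by rewrite (le_trans (ler_normB _ _))// lerD2l.
pose beta (x : 'rV[R]_n) : R := \prod_b flat 1 (c ^+ 2 - (x 0 b - x0 0 b) ^+ 2).
pose v q : R := if pselect (dom i q) then beta (crd i q) else 0.
have flat_ge0 t : 0 <= flat 1 t :> R.
  by rewrite /flat; case: ifP => // _; rewrite hornerC mul1r expR_ge0.
have vE q : dom i q -> v q = beta (crd i q) by rewrite /v; case: pselect.
have vK q : ~ K q -> v q = 0.
  move=> nK; rewrite /v; case: pselect => // iq.
  apply/eqP; apply: contrapT => /negP bn0; apply: nK.
  exists (crd i q); last exact: parK.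
  rewrite closed_ballE// /closed_ball_ /=.
  rewrite -[`|x0 - crd i q|]/(mx_norm (x0 - crd i q)) mx_normrE.
  apply: bigmax_le => [|[a b] _ /=]; first exact: ltW.
  rewrite !mxE ord1 leNgt; apply/negP => lt.
  move/negP: bn0; apply; rewrite /beta (bigD1 b)//= mulf_eq0 /flat ifN ?eqxx//.
  rewrite -leNgt subr_le0 -(real_normK (num_real (_ - _))) distrC.
  by rewrite ler_sqr ?nnegrE// ltW.
exists v; split; last first.
  rewrite vE//; apply: prodr_gt0 => b _; rewrite subrr expr0n subr0/=.
  by rewrite /flat exprn_gt0// hornerC mul1r expR_gt0.
split.
(* M is covered by the domain of chart i, where v is a composite of smooth functions, and by the
   complement of K, where v is 0. The latter is open because M is Hausdorff. *)
- move=> j k; apply: Ck_local => [|y [q jq <-]]; first exact: open_img.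
  have [iq|niq] := pselect (dom i q).
    exists (crd j @` (dom j `&` dom i)); split.
    - rewrite setIC crd_image; apply: within_open_preimage.
      + exact: open_img.
      + exact: cinv_continuous.
      + exact: open_dom.
    - by exists q.
    have oV : open (crd j @` (dom j `&` dom i)).
      rewrite setIC crd_image; apply: within_open_preimage.
      + exact: open_img.
      + exact: cinv_continuous.
      + exact: open_dom.
    apply: (@Ck_ext _ _ _ _ (fun x => beta (crd i (par j x)))) => //.
      move=> x; rewrite inE => -[q' [jq' iq'] <-].
      by rewrite /= vE// parK.
    apply: Ck_prod => // b; apply: Ck_flat => //; apply: Ck_add => //.
      exact: Ck_cst.
    have sm : Ck k (crd j @` (dom j `&` dom i)) (fun x => crd i (par j x) 0 b - x0 0 b).
      by apply: Ck_add => //; [exact: charts_compatible|exact: Ck_cst].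
    apply: (@Ck_ext _ _ _ _ (fun x =>
        -1 * ((crd i (par j x) 0 b - x0 0 b) * (crd i (par j x) 0 b - x0 0 b)))) => //.
      by move=> x _; rewrite mulN1r expr2.
    by apply: Ck_mul => //; [exact: Ck_cst|exact: Ck_mul].
  exists (crd j @` (~` K `&` dom j)).
  have oV : open (crd j @` (~` K `&` dom j)).
    rewrite crd_image; apply: within_open_preimage.
    + exact: open_img.
    + exact: cinv_continuous.
    + by apply: closed_openC; exact: compact_closed (@carrier_hausdorff _ _ M) cK.
  split=> //; first by exists q => //; split=> // /Ki.
  apply: (@Ck_ext _ _ _ _ (fun=> 0)) => //; last exact: Ck_cst.
  by move=> x; rewrite inE => -[q' [nK jq'] <-]; rewrite /= parK// vK.
- move=> q; have [iq|niq] := pselect (dom i q).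
    by rewrite vE//; apply: prodr_ge0 => b _.
  by rewrite vK// => /Ki.
- by exists K.
Qed.

(** Suppose that no bump is >= 1 on C. The sets containing some {p in C : v p < 1} then form a
    proper filter, because bumps can be added. It has a cluster point p in C, and a bump with value
    2 at p is a contradiction. *)
Lemma compact_bump (C : set M) : compact C ->
  exists2 v, bump_function v & forall p, C p -> 1 <= v p.
Proof.
move=> cC.
pose F : set_system M := [set A | exists2 v, bump_function v & forall p, C p -> v p < 1 -> A p].
have FF : Filter F.
  split.
  - by exists (fun=> 0) => //; exact: bump0.
  - move=> A B [u bu uA] [v bv vB].
    exists (fun p => u p + v p); first exact: bump_add.
    have [_ u0 _] := bu; have [_ v0 _] := bv.
    move=> p Cp uv; split; [apply: uA|apply: vB] => //.
      by rewrite (le_lt_trans _ uv)// lerDl.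
    by rewrite (le_lt_trans _ uv)// lerDr.
  - by move=> A B AB [u bu uA]; exists u => // p Cp /(uA p Cp)/AB.
have [[v bv v0]|nF0] := pselect (F set0).
  by exists v => // p Cp; rewrite leNgt; apply/negP => /(v0 p Cp).
have PF : ProperFilter F by [].
have [p [Cp clp]] : (C `&` cluster F) !=set0.
  by apply: cC => //; exists (fun=> 0) => //; exact: bump0.
have [u [bu up]] := chart_bump p.
pose v q := 2 / u p * u q.
have bv : bump_function v by apply: bump_scale => //; rewrite divr_ge0// ltW.
have vp : v p = 2 by rewrite /v mulfVK// gt_eqF.
have F1 : F [set q | C q /\ v q < 1] by exists v.
have N1 : nbhs p [set q | 1 < v q].
  have [sv _ _] := bv.
  apply: (smooth_continuous_on sv (t := [set t | 1 < t])).
  apply: open_nbhs_nbhs; split; first exact: open_gt.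
  by rewrite /= vp ltr1n.
have [q [[_ q1] q2]] := clp _ _ F1 N1.
by have := lt_trans q1 q2; rewrite ltxx.
Qed.

End bumps.

(** * Numerical inequalities for damped functions *)

Section damping.
Context {R : realType}.
Implicit Types A Aw Z V S T z e : R.

Lemma damping_potential V S T z : 0 <= V -> 0 <= z <= 4^-1 -> `|S| <= T ->
  S * ((1 - z) ^+ 2 * V) <= S * V + 2 * T * z * V.
Proof.
move=> V0 /andP[z0 z4] ST.
have -> : S * ((1 - z) ^+ 2 * V) = S * V + (- S) * ((2 - z) * z * V) by ring.
rewrite lerD2l.
have zV : 0 <= z * V by exact: mulr_ge0.
have y0 : 0 <= (2 - z) * z * V by rewrite -mulrA mulr_ge0//; lra.
have T0 : 0 <= T by exact: le_trans ST.
apply: le_trans (ler_wpM2r y0 (_ : - S <= T)) _.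
  by rewrite (le_trans _ ST)// -normrN ler_norm.
rewrite [leRHS](_ : _ = T * (2 * z * V)); last by ring.
by rewrite ler_wpM2l// -!mulrA ler_wpM2r//; lra.
Qed.

(** Here V = v^2, W = w^2 and z = zeta^2; A, Aw, Z are the gradient terms of v, w, zeta; S is the
    scalar curvature, T a bound for its absolute value, and e the error of the change of metric. The
    error falls on w and is absorbed since (1 + z/2) (1 - z) <= 1 is available twice in (1 + e) (1 +
    z/2) (1 - z)^2. *)
Lemma damping_l A Aw Z V W S T z e : W = (1 - z) ^+ 2 * V ->
  0 <= A -> 0 <= Aw -> 0 <= Z -> 0 <= V -> 0 <= z <= 4^-1 -> 0 <= e <= z / 2 ->
  `|S| <= T -> Aw <= (1 + z / 2) * (1 - z) ^+ 2 * A + 9 * (Z * V) ->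
  Aw + S * W + e * (Aw + W) <= A + S * V + (18 * Z + (2 * T + 4) * z) * V.
Proof.
move=> WE A0 Aw0 Z0 V0 z04 /andP[e0 ez] ST AwE.
have := damping_potential V0 z04 ST; rewrite -WE => h3; have /andP[z0 z4] := z04.
have zV : 0 <= z * V by exact: mulr_ge0.
have ZV : 0 <= Z * V by exact: mulr_ge0.
have WV : W <= V by rewrite WE ler_piMl// expr2; nra.
have W0 : 0 <= W by rewrite WE mulr_ge0// sqr_ge0.
have h1 : (1 + e) * Aw <= A + 18 * (Z * V).
  apply: (@le_trans _ _ ((1 + z / 2) * Aw)); first by rewrite ler_wpM2r// lerD2l.
  apply: le_trans (ler_wpM2l _ AwE) _; first by lra.
  rewrite mulrDr lerD//.
    rewrite mulrA ler_piMl//.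
    have -> : (1 + z / 2) * ((1 + z / 2) * (1 - z) ^+ 2) = ((1 + z / 2) * (1 - z)) ^+ 2 by ring.
    by rewrite -[leRHS](expr1n _ 2) lerXn2r ?nnegrE//; nra.
  by rewrite [leLHS]mulrA ler_wpM2r//; lra.
have h2 : e * W <= z * V by apply: ler_pM => //; lra.
lra.
Qed.

(** Same reading, with the error on v: the factor (1 + z/2) (1 - z)^2 is at most 1 - z/2 <= 1 -
    e. *)
Lemma damping_r A Aw Z V W S T z e : W = (1 - z) ^+ 2 * V ->
  0 <= A -> 0 <= Aw -> 0 <= Z -> 0 <= V -> 0 <= z <= 4^-1 -> 0 <= e <= z / 2 ->
  `|S| <= T -> Aw <= (1 + z / 2) * (1 - z) ^+ 2 * A + 9 * (Z * V) ->
  Aw + S * W <= A + S * V - e * (A + V) + (18 * Z + (2 * T + 4) * z) * V.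
Proof.
move=> WE A0 Aw0 Z0 V0 z04 /andP[e0 ez] ST AwE.
have := damping_potential V0 z04 ST; rewrite -WE => h3; have /andP[z0 z4] := z04.
have zV : 0 <= z * V by exact: mulr_ge0.
have ZV : 0 <= Z * V by exact: mulr_ge0.
have h1 : (1 + z / 2) * (1 - z) ^+ 2 * A <= (1 - e) * A.
  rewrite ler_wpM2r// (@le_trans _ _ (1 - z / 2))//; last by lra.
  rewrite (@le_trans _ _ ((1 + z / 2) * (1 - z)))//; last by nra.
  by rewrite expr2 mulrA ler_piMr//; nra.
have h2 : e * V <= z * V by rewrite ler_wpM2r//; lra.
lra.
Qed.

End damping.

(** * Pointwise energy estimates *)

Section energy_density.
Context {R : realType} {n : nat} (M : smooth_manifold R n).
Implicit Types (g h : metric M) (p : M) (u v : M -> R).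
Local Notation a := (@yamabe_coef R n).

Definition dcov v p : 'rV[R]_n :=
  \row_b partial b (v \o par (chart_at p)) (crd (chart_at p) p).

Lemma sqnorm_diffE g v p :
  sqnorm_diff g v p = qf (invmx (g (chart_at p) p)) (dcov v p).
Proof. by []. Qed.

Lemma chart_at_img p : img (chart_at p) (crd (chart_at p) p).
Proof. by exists p => //; exact: chart_atP. Qed.

Lemma smooth_derivable_at v p b : smooth v ->
  derivable (v \o par (chart_at p)) (crd (chart_at p) p) (delta_mx 0 b).
Proof. by move=> sv; apply: smooth_derivable (sv _) (chart_at_img p). Qed.

Lemma dcovD u v p : smooth u -> smooth v ->
  dcov (fun q => u q + v q) p = dcov u p + dcov v p.
Proof.
move=> su sv; apply/rowP => b; rewrite !mxE.
by apply: (@partialD _ _ _ (u \o par _) (v \o par _)); exact: smooth_derivable_at.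
Qed.

Lemma dcovM u v p : smooth u -> smooth v ->
  dcov (fun q => u q * v q) p = u p *: dcov v p + v p *: dcov u p.
Proof.
move=> su sv; apply/rowP => b; rewrite !mxE.
rewrite -[X in _ = X * _ + _](_ : (u \o par (chart_at p)) (crd (chart_at p) p) = u p); last first.
  by rewrite /= parK//; exact: chart_atP.
rewrite -[X in _ = _ + X * _](_ : (v \o par (chart_at p)) (crd (chart_at p) p) = v p); last first.
  by rewrite /= parK//; exact: chart_atP.
by apply: (@partialM _ _ _ (u \o par _) (v \o par _)); exact: smooth_derivable_at.
Qed.

Lemma dcov_cst c p : dcov (fun=> c) p = 0.
Proof. by apply/rowP => b; rewrite !mxE; exact: derive_cst. Qed.

Lemma dcov_out v (K : set M) p : closed K -> (forall q, ~ K q -> v q = 0) ->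
  ~ K p -> dcov v p = 0.
Proof.
move=> cK v0 np; rewrite -(dcov_cst 0 p); apply/rowP => b; rewrite !mxE.
apply: (@partial_ext _ _ _ (crd (chart_at p) @` (~` K `&` dom (chart_at p)))).
- rewrite crd_image; apply: within_open_preimage.
  + exact: open_img.
  + exact: cinv_continuous.
  + exact: closed_openC.
- by move=> x; rewrite inE => -[q [nq iq] <-]; rewrite /= parK// v0.
- by exists p => //; split=> //; exact: chart_atP.
Qed.

Lemma inv_posdef g p : posdef (invmx (g (chart_at p) p)).
Proof. by apply: posdef_inv; apply: metric_posdef; exact: chart_atP. Qed.

Lemma scal_jetE g p : scal g p =
  jet_scal (jet_of (loc g (chart_at p)) (crd (chart_at p) p)).
Proof.
apply: (@scalar_curvature_jet _ _ (img (chart_at p))).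
- exact: open_img.
- exact: smooth_loc.
- by move=> x; exact: loc_det_neq0.
- exact: chart_at_img.
Qed.

Lemma cellwise_scal g : cellwise (scal g).
Proof.
apply: (@cellwise_chart _ _ _ _ (fun i x => jet_scal (jet_of (loc g i) x))).
  move=> i x ix; have cj := @jet_of_loc_continuous _ _ _ g _ _ ix.
  exact: (@cvg_jet_scal _ _ _ _ (nbhs_filter x) _ _ cj (loc_det_neq0 g ix)).
exact: scal_jetE.
Qed.

Lemma cellwise_sqnorm_diff g v : smooth v -> cellwise (sqnorm_diff g v).
Proof.
move=> sv; apply: (@cellwise_chart _ _ _ _ (fun i x =>
    qf (invmx (loc g i x)) (\row_b partial b (v \o par i) x))).
  move=> i x ix.
  have c1 := @cvg_invmx _ _ _ (nbhs_filter x) _ _ _ (loc_det_neq0 g ix)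
    (@loc_continuous _ _ M g _ _ ix).
  suff c2 : {for x, continuous (fun y => \row_b partial b (v \o par i) y)}.
    exact: (@cvg_qf _ _ _ (nbhs_filter x) _ _ _ _ _ c1 c2).
  apply/continuous_mxP => j b.
  have c := smooth_on_continuous_at (@open_img _ _ _ i) (smooth_partial b (sv i)) ix.
  by congr (continuous_at _ _): c; apply/funext => y; rewrite mxE.
by move=> p; rewrite sqnorm_diffE /loc parK//; exact: chart_atP.
Qed.

Definition energy_density g v p : R := a * sqnorm_diff g v p + scal g p * v p ^+ 2.

Lemma cellwise_energy_density g v : smooth v -> cellwise (energy_density g v).
Proof.
move=> sv; apply: cellwise_add; apply: cellwise_mul.
- exact: cellwise_cst.
- exact: cellwise_sqnorm_diff.
- exact: cellwise_scal.
- by apply: cellwise_sqr; exact: cellwise_smooth.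
Qed.

Lemma energy_density_out g v (K : set M) p : closed K ->
  (forall q, ~ K q -> v q = 0) -> ~ K p -> energy_density g v p = 0.
Proof.
move=> cK v0 np; rewrite /energy_density sqnorm_diffE (dcov_out cK v0 np).
by rewrite qf0 v0// expr0n/= !mulr0 addr0.
Qed.

(* Bounds the energy lost when a function is damped by 1 - v ^ 2, per unit of its
   square. *)
Definition weight g v p : R :=
  18 * a * sqnorm_diff g v p + (2 * `|scal g p| + 4) * v p ^+ 2.

Lemma cellwise_weight g v : smooth v -> cellwise (weight g v).
Proof.
move=> sv; apply: cellwise_add; apply: cellwise_mul.
- exact: cellwise_cst.
- exact: cellwise_sqnorm_diff.
- apply: cellwise_add; last exact: cellwise_cst.
  by apply: cellwise_mul; [exact: cellwise_cst|apply: cellwise_norm; exact: cellwise_scal].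
- by apply: cellwise_sqr; exact: cellwise_smooth.
Qed.

Lemma weight_out g v (K : set M) p : closed K ->
  (forall q, ~ K q -> v q = 0) -> ~ K p -> weight g v p = 0.
Proof.
move=> cK v0 np; rewrite /weight sqnorm_diffE (dcov_out cK v0 np).
by rewrite qf0 v0// expr0n/= !mulr0 addr0.
Qed.

Hypothesis n3 : (3 <= n)%N.

Lemma yamabe_coef_gt0 : 0 < a.
Proof.
have n3R : 3 <= n%:R :> R by rewrite (ler_nat _ 3).
by rewrite /yamabe_coef divr_gt0//; lra.
Qed.

Lemma sqnorm_diff_ge0 g v p : 0 <= sqnorm_diff g v p.
Proof. by rewrite sqnorm_diffE posdef_ge0//; exact: inv_posdef. Qed.

Lemma weight_ge0 g v p : 0 <= weight g v p.
Proof.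
rewrite /weight addr_ge0// mulr_ge0 ?sqnorm_diff_ge0 ?sqr_ge0//.
by rewrite mulr_ge0// ltW// yamabe_coef_gt0.
Qed.

Lemma weightD g u v p : smooth u -> smooth v ->
  weight g (fun q => u q + v q) p <= 2 * weight g u p + 2 * weight g v p.
Proof.
move=> su sv; rewrite /weight !sqnorm_diffE dcovD//.
have := qf_add_le (dcov u p) (dcov v p) (inv_posdef g p) ltr01.
rewrite invr1 => qle; have a0 := yamabe_coef_gt0.
have sle : (u p + v p) ^+ 2 <= 2 * u p ^+ 2 + 2 * v p ^+ 2.
  by have := sqr_ge0 (u p - v p); rewrite !expr2; nra.
have s0 : 0 <= 2 * `|scal g p| + 4 by rewrite addr_ge0// mulr_ge0.
have a18 : 0 <= 18 * a by rewrite mulr_ge0// ltW.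
have := ler_wpM2l a18 qle; have := ler_wpM2l s0 sle; lra.
Qed.

Lemma weightZ g (c : R) v p : smooth v ->
  weight g (fun q => c * v q) p = c ^+ 2 * weight g v p.
Proof.
move=> sv; rewrite /weight !sqnorm_diffE.
rewrite (dcovM p (smooth_cst c) sv) dcov_cst scaler0 addr0 qfZ; ring.
Qed.

Lemma weight0 g p : weight g (fun=> 0) p = 0.
Proof. by rewrite /weight sqnorm_diffE dcov_cst qf0 expr0n/= !mulr0 addr0. Qed.

(** Each use of [weightD] splits off the first summand and doubles the bound for all later ones. *)
Lemma weight_sum g (x : nat -> M -> R) N p : (forall k, smooth (x k)) ->
  weight g (fun q => \sum_(k < N) x k q) p <=
  \sum_(k < N) 2 ^+ k.+1 * weight g (x k) p.
Proof.
move=> sx; have ss m (y : nat -> M -> R) : (forall k, smooth (y k)) ->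
    smooth (fun q => \sum_(k < m) y k q).
  move=> sy i k; apply: (@Ck_sum _ _ k _ _ _ (fun j : 'I_m => y j \o par i)) => [|j].
    exact: open_img.
  exact: sy.
elim: N x sx => [|N IH] x sx.
  rewrite big_ord0 (_ : (fun q => _) = (fun=> 0)) ?weight0//.
  by apply/funext => q; rewrite big_ord0.
rewrite (_ : (fun q => _) = (fun q => x 0%N q + \sum_(k < N) x k.+1 q)); last first.
  by apply/funext => q; rewrite big_ord_recl.
apply: le_trans (weightD _ _ (sx 0%N) (ss N _ (fun k => sx k.+1))) _.
rewrite big_ord_recl/= expr1 lerD2l.
have := IH (fun k => x k.+1) (fun k => sx k.+1).
move=> /(ler_wpM2l (ler0n R 2))/le_trans; apply.
by rewrite mulr_sumr; apply: ler_sum => k _; rewrite mulrA -exprS.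
Qed.

(** Young's inequality with s = zeta^2 / 2 for dw = (1 - zeta^2) dv - 2 zeta v dzeta. The second
    term gets (1 + 2 / zeta^2) 4 zeta^2 = 4 zeta^2 + 8, at most 9 because zeta <= 1/2. *)
Lemma sqnorm_diff_damped g zeta v p : smooth zeta -> smooth v -> 0 < zeta p <= 2^-1 ->
  sqnorm_diff g (fun q => (1 - zeta q ^+ 2) * v q) p <=
    (1 + zeta p ^+ 2 / 2) * (1 - zeta p ^+ 2) ^+ 2 * sqnorm_diff g v p +
    9 * v p ^+ 2 * sqnorm_diff g zeta p.
Proof.
move=> sz sv /andP[z0 z1]; rewrite !sqnorm_diffE.
have -> : dcov (fun q => (1 - zeta q ^+ 2) * v q) p =
    (1 - zeta p ^+ 2) *: dcov v p + (- 2 * zeta p * v p) *: dcov zeta p.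
  have -> : (fun q => (1 - zeta q ^+ 2) * v q) =
      (fun q => (1 + (- 1 * zeta q) * zeta q) * v q).
    by apply/funext => q; rewrite mulN1r mulNr expr2.
  have s1 := smooth_mul (@smooth_cst _ _ M (-1)) sz.
  have s2 := smooth_mul s1 sz.
  have s3 := smooth_add (@smooth_cst _ _ M 1) s2.
  rewrite (dcovM p s3 sv) (dcovD p (@smooth_cst _ _ M 1) s2) (dcovM p s1 sz).
  rewrite (dcovM p (@smooth_cst _ _ M (-1)) sz) !dcov_cst scaler0 addr0 add0r.
  apply/rowP => b; rewrite !mxE; ring.
have s0 : 0 < zeta p ^+ 2 / 2 by rewrite divr_gt0// exprn_gt0.
apply: le_trans (qf_add_le _ _ (inv_posdef g p) s0) _.
rewrite !qfZ mulrA lerD2l mulrA.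
rewrite ler_wpM2r ?posdef_ge0//; first exact: inv_posdef.
have -> : (1 + (zeta p ^+ 2 / 2)^-1) * (- 2 * zeta p * v p) ^+ 2 =
   (4 * zeta p ^+ 2 + 8) * v p ^+ 2 by field; rewrite gt_eqF.
by rewrite ler_wpM2r ?sqr_ge0//; rewrite expr2; nra.
Qed.

Section comparison.
Variables (g h : metric M) (e : R) (p : M).
Let r := ratio g h p.
Hypothesis e_r : `|r - 1| <= e.
Hypothesis e_q : forall u : 'rV[R]_n, `|r * qf (invmx (h (chart_at p) p)) u
  - qf (invmx (g (chart_at p) p)) u| <= e * qf (invmx (g (chart_at p) p)) u.
Hypothesis e_s : `|r * scal h p - scal g p| <= e.

Lemma energy_density_compare v :
  `|r * energy_density h v p - energy_density g v p| <=
    e * (a * sqnorm_diff g v p + v p ^+ 2).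
Proof.
rewrite /energy_density !sqnorm_diffE; have a0 := yamabe_coef_gt0.
have := e_q (dcov v p); set Ah := qf _ _; set A := qf _ _ => eA.
have E (x b B C s t y : R) : x * (b * B + s * y) - (b * C + t * y) =
  b * (x * B - C) + (x * s - t) * y by ring.
rewrite E; apply: le_trans (ler_normD _ _) _; rewrite [leRHS]mulrDr; apply: lerD.
  by rewrite normrM gtr0_norm// mulrCA ler_wpM2l// ltW.
by rewrite normrM [X in _ * X <= _]ger0_norm ?sqr_ge0// ler_wpM2r ?sqr_ge0.
Qed.

Variables (zeta v : M -> R).
Hypotheses (sz : smooth zeta) (sv : smooth v).
Hypothesis z_p : 0 < zeta p <= 2^-1.
Hypothesis e_z : e <= zeta p ^+ 2 / 2.

Let w q := (1 - zeta q ^+ 2) * v q.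

Let coef_ge0 u q : 0 <= a * sqnorm_diff g u q.
Proof. by rewrite mulr_ge0 ?sqnorm_diff_ge0// ltW// yamabe_coef_gt0. Qed.

Let z_le : 0 <= zeta p ^+ 2 <= 4^-1.
Proof. by rewrite sqr_ge0/=; move: z_p => /andP[z0 z1]; rewrite expr2; nra. Qed.

Let e_le : 0 <= e <= zeta p ^+ 2 / 2.
Proof. by rewrite e_z andbT; exact: le_trans e_r. Qed.

Let damped_gradient : a * sqnorm_diff g w p <=
  (1 + zeta p ^+ 2 / 2) * (1 - zeta p ^+ 2) ^+ 2 * (a * sqnorm_diff g v p)
  + 9 * (a * sqnorm_diff g zeta p * v p ^+ 2).
Proof.
have := sqnorm_diff_damped g sz sv z_p; rewrite -/w.
move=> /(ler_wpM2l (ltW yamabe_coef_gt0))/le_trans; apply.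
rewrite mulrDr lerD//; first by rewrite mulrCA.
by rewrite -mulrA mulrCA -mulrA [v p ^+ 2 * _]mulrC.
Qed.

(** The metric is exchanged at w, after damping; in [energy_density_damped_compare_r] it is
    exchanged at v, before damping. The error is measured by g in both cases. *)
Lemma energy_density_damped_compare_l :
  r * energy_density h w p <= energy_density g v p + weight g zeta p * v p ^+ 2.
Proof.
have := energy_density_compare w; rewrite ler_norml => /andP[_].
rewrite lerBlDl => /le_trans; apply.
have wE : w p ^+ 2 = (1 - zeta p ^+ 2) ^+ 2 * v p ^+ 2 by rewrite exprMn.
have := damping_l wE (coef_ge0 v p) (coef_ge0 w p) (coef_ge0 zeta p) (sqr_ge0 (v p))
  z_le e_le (lexx `|scal g p|) damped_gradient.
by rewrite /energy_density /weight [18 * (_ * _)]mulrA.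
Qed.

Lemma energy_density_damped_compare_r :
  energy_density g w p <= r * energy_density h v p + weight g zeta p * v p ^+ 2.
Proof.
have := energy_density_compare v; rewrite ler_norml => /andP[+ _].
rewrite lerBrDl -(lerD2r (weight g zeta p * v p ^+ 2)); apply: le_trans.
have wE : w p ^+ 2 = (1 - zeta p ^+ 2) ^+ 2 * v p ^+ 2 by rewrite exprMn.
have := damping_r wE (coef_ge0 v p) (coef_ge0 w p) (coef_ge0 zeta p) (sqr_ge0 (v p))
  z_le e_le (lexx `|scal g p|) damped_gradient.
by rewrite /energy_density /weight [18 * (_ * _)]mulrA.
Qed.

End comparison.
End energy_density.

(** * Construction of the damping functions *)

Section weight_family.
Context {R : realType} {n : nat} (M : smooth_manifold R n).
Implicit Types (g h : metric M) (p : M) (u v : M -> R).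
Local Notation mu := (@riemannian_measure R n M).
Local Notation bM := (@borel R n M).
Local Notation C := (cover_set (the_cover M)).

(** Finitely many sets of the cover contain K, and a cell avoids every set of the cover with a
    smaller index. *)
Lemma compact_cells (K : set M) : compact K ->
  exists N, forall p k, K p -> cell k p -> (k < N)%N.
Proof.
rewrite compact_cover => cK.
have [|p Kp|D _ KD] := cK nat setT (fun k => (C k)°).
- by move=> k _; exact: open_interior.
- by have : (\bigcup_k (C k)°) p by rewrite cover_interior.
exists (\max_(i <- finmap.enum_fset D) i).+1 => p k Kp [_ nC].
have [l /= lD lp] := KD p Kp; rewrite ltnS leqNgt; apply/negP => lk.
apply: nC; rewrite -bigcup_mkord; exists l => /=; last exact: interior_subset.
by rewrite (leq_ltn_trans _ lk)//; apply: leq_bigmax_seq.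
Qed.

Lemma compact_closed_manifold (K : set M) : compact K -> closed K.
Proof. exact: compact_closed (@carrier_hausdorff _ _ M). Qed.

Lemma integrable_compact_support g (f : M -> R) (K : set M) : compact K ->
  cellwise f -> (forall p, ~ K p -> f p = 0) -> (mu g).-integrable setT (EFin \o (f : bM -> R)).
Proof.
move=> cK cf f0; have [N NP] := compact_cells cK.
apply: (@cellwise_integrable R n M g f N cf) => p np; apply: f0 => Kp.
have [k kp] := ex_cell p; exact: (np k (NP p k Kp kp) kp).
Qed.

Lemma bounded_compact_support (f : M -> R) (K : set M) : compact K ->
  cellwise f -> (forall p, ~ K p -> f p = 0) ->
  exists2 B, 0 <= B & forall p, `|f p| <= B.
Proof.
move=> cK cf f0; have [N NP] := compact_cells cK.
have [B B0 fB] : exists2 B, 0 <= B & forall p k, (k < N)%N -> cell k p -> `|f p| <= B.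
  elim: N {NP} => [|N [B B0 fB]]; first by exists 0.
  have [B' B'0 fB'] := cellwise_bounded N cf.
  exists (B + B'); first exact: addr_ge0.
  move=> p k; rewrite ltnS leq_eqVlt => /predU1P[->|kN] kp.
    by rewrite (le_trans (fB' p kp))// lerDr.
  by rewrite (le_trans (fB p k kN kp))// lerDl.
exists B => // p; have [Kp|nK] := pselect (K p); last by rewrite f0 ?normr0.
by have [k kp] := ex_cell p; apply: (fB p k) => //; exact: NP kp.
Qed.

Let four_expr k : 4 ^+ k = 2 ^+ k * 2 ^+ k :> R.
Proof. by rewrite -exprMn; congr (_ ^+ _); ring. Qed.

Hypothesis n3 : (3 <= n)%N.

(* The scaling makes the sum over k of 2 ^ k.+1 times the weights of the
   functions x k, and the integral of this sum, at most 1. *)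
Lemma weighted_bumps g : exists (x : nat -> M -> R) (c : nat -> R),
  forall k, [/\ bump_function (x k), 0 < c k, forall p, C k p -> c k <= x k p,
    forall p, 4 ^+ k.+1 * weight g (x k) p <= 1 &
    (\int[mu g]_p (4 ^+ k.+1 * weight g (x k) p)%:E <= 1)%E].
Proof.
suff H k : exists xc : (M -> R) * R, [/\ bump_function xc.1, 0 < xc.2,
    forall p, C k p -> xc.2 <= xc.1 p,
    forall p, 4 ^+ k.+1 * weight g xc.1 p <= 1 &
    (\int[mu g]_p (4 ^+ k.+1 * weight g xc.1 p)%:E <= 1)%E].
  have [xc xcP] := choice H.
  by exists (fun k => (xc k).1), (fun k => (xc k).2).
have [v bv v1] := compact_bump (@Defs.cover_compact _ _ _ (the_cover M) k).
have [sv v0 [K cK vK]] := bv.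
have cw := cellwise_weight g sv.
have w0 p : ~ K p -> weight g v p = 0.
  by move=> nK; apply: weight_out vK nK; exact: compact_closed_manifold.
have [B B0 wB] := bounded_compact_support cK cw w0.
have iw := integrable_compact_support g cK cw w0.
pose I := \int[mu g]_p weight g v p.
have I0 : 0 <= I by apply: Rintegral_ge0 => p _; exact: weight_ge0.
(* m exceeds both the supremum and the integral of the weight. The weight is quadratic in the
   function, so the scale 1 / (2^(k+1) m) turns the factor 4^(k+1) into 1 / m^2. *)
pose m := 1 + B + I; have m1 : 1 <= m by rewrite /m -addrA lerDl addr_ge0.
have m0 : 0 < m by exact: lt_le_trans m1.
pose c : R := (2 ^+ k.+1 * m)^-1.
have c0 : 0 < c by rewrite invr_gt0 mulr_gt0// exprn_gt0.
have cE p : 4 ^+ k.+1 * weight g (fun q => c * v q) p = m ^- 2 * weight g v p.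
  rewrite weightZ// /c mulrA; congr (_ * _); rewrite four_expr.
  by field; rewrite expf_neq0//= gt_eqF.
have mm (y : R) : 0 <= y -> y <= m -> m ^- 2 * y <= 1.
  move=> y0 ym; rewrite mulrC ler_pdivrMr ?exprn_gt0// mul1r expr2.
  by rewrite (le_trans ym)// ler_peMl// ltW.
exists (fun q => c * v q, c); split => //=.
- by apply: bump_scale => //; exact: ltW.
- by move=> p kp; rewrite ler_peMr ?v1// ltW.
- move=> p; rewrite cE mm ?weight_ge0// (le_trans (ler_norm _))// (le_trans (wB p))//.
  by rewrite /m; lra.
- under eq_integral do rewrite cE EFinM.
  rewrite ge0_integralZl_EFin//.
  + rewrite -(fineK (integrable_fin_num _ iw))// -EFinM lee_fin; apply: mm => //.
    by apply: (@le_trans _ _ I); [exact: lexx|rewrite /m; lra].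
  + by move=> p _; rewrite lee_fin weight_ge0.
  + apply/measurable_EFinP; exact: (cellwise_measurable cw).
  + by rewrite invr_ge0 exprn_ge0// ltW.
Qed.

(** The numbers [c k] come before K because they define the neighborhood of g, while zeta may depend
    on the support K of a test function. Summing the bumps of the first N cells is enough when these
    cells contain K. *)
Lemma weight_family g : exists c : nat -> R, (forall k, 0 < c k) /\
  forall K : set M, compact K -> exists zeta F : M -> R,
    [/\ bump_function zeta /\ (forall p, zeta p <= 2^-1),
        (forall p k, K p -> cell k p -> c k <= zeta p), cellwise F,
        (forall p, weight g zeta p <= F p <= 1) &
        (\int[mu g]_p (F p)%:E <= 1)%E].
Proof.
have [x [c xP]] := weighted_bumps g; exists c; split; first by move=> k; have [] := xP k.
have bx k : bump_function (x k) by have [] := xP k.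
have sx k : smooth (x k) by have [] := bx k.
have x0 k p : 0 <= x k p by have [] := bx k.
move=> K cK; have [N NP] := compact_cells cK.
pose zeta p := \sum_(k < N) x k p.
pose F p := \sum_(k < N) 2 ^+ k.+1 * weight g (x k) p.
have geom m : \sum_(k < m) 2 ^- k.+1 <= 1 :> R.
  suff -> : \sum_(k < m) 2 ^- k.+1 = 1 - 2 ^- m :> R by rewrite gerBl invr_ge0 exprn_ge0.
  elim: m => [|m IH]; first by rewrite big_ord0 expr0 invr1 subrr.
  by rewrite big_ord_recr/= IH exprS; field; rewrite expf_neq0.
(* Weights are at most 4^-(k+1), so with the factors of [weight_sum] they are dominated by a
   geometric series of sum at most 1. *)
have p2 k : 2 ^+ k.+1 = 2 ^- k.+1 * 4 ^+ k.+1 :> R.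
  by rewrite four_expr mulrA mulVf ?mul1r// expf_neq0.
have F1 p : F p <= 1.
  apply: le_trans (geom N); apply: ler_sum => k _; rewrite [X in X * _ <= _]p2 -mulrA.
  by have [_ _ _ /(_ p) h _] := xP k; rewrite ler_piMr// invr_ge0 exprn_ge0.
have WF p : weight g zeta p <= F p by exact: weight_sum.
have cF : cellwise F.
  rewrite /F; elim: N {NP zeta F F1 WF} => [|N IH].
    rewrite (_ : (fun p => _) = fun=> 0); first exact: cellwise_cst.
    by apply/funext => p; rewrite big_ord0.
  rewrite (_ : (fun p => _) = fun p => \sum_(k < N) 2 ^+ k.+1 * weight g (x k) p +
    2 ^+ N.+1 * weight g (x N) p); last by apply/funext => p; rewrite big_ord_recr.
  apply: cellwise_add => //; apply: cellwise_mul; first exact: cellwise_cst.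
  exact: cellwise_weight.
exists zeta, F; split=> //.
- split; last first.
    move=> p; have z0 : 0 <= zeta p by apply: sumr_ge0 => i _; exact: x0.
    (* The bound zeta <= 1/2 comes for free: the weight contains 4 zeta^2 and is at most 1. *)
    have key (y S D a : R) : 0 <= y -> 0 <= S -> 0 <= D -> 0 < a ->
        18 * a * D + (2 * S + 4) * y ^+ 2 <= 1 -> y <= 2^-1.
      move=> y0 S0 D0 a0 h; rewrite leNgt; apply/negP => y12.
      have : 0 <= a * D by rewrite mulr_ge0// ltW.
      have : 0 <= S * y ^+ 2 by rewrite mulr_ge0// sqr_ge0.
      have : 2^-1 * 2^-1 < y ^+ 2 by rewrite expr2 ltr_pM.
      lra.
    apply: key (le_trans (WF p) (F1 p)) => //; first exact: sqnorm_diff_ge0.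
    exact: yamabe_coef_gt0.
  rewrite /zeta; elim: N {NP zeta F F1 WF cF} => [|N IH].
    rewrite (_ : (fun p => _) = fun=> 0); first exact: bump0.
    by apply/funext => p; rewrite big_ord0.
  rewrite (_ : (fun p => _) = fun p => \sum_(k < N) x k p + x N p).
    exact: bump_add.
  by apply/funext => p; rewrite big_ord_recr.
- move=> p k Kp kp; have kN := NP p k Kp kp.
  have [_ _ ck _ _] := xP k; rewrite (le_trans (ck p _))//; first by case: kp.
  rewrite /zeta (bigD1 (Ordinal kN))//= lerDl sumr_ge0// => i _; exact: x0.
- by move=> p; rewrite WF F1.
have mw (b : R) k : measurable_fun setT (fun p : bM => (b * weight g (x k) p)%:E).
  apply/measurable_EFinP; apply: cellwise_measurable.
  by apply: cellwise_mul; [exact: cellwise_cst|exact: cellwise_weight].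
rewrite /F; under eq_integral do rewrite -sumEFin.
rewrite ge0_integral_sum//.
- apply: (@le_trans _ _ (\sum_(k < N) (2 ^- k.+1)%:E)%E); last by rewrite sumEFin lee_fin.
  apply: lee_sum => k _.
  have [_ _ _ _ h] := xP k.
  under eq_integral do rewrite p2 -mulrA EFinM.
  rewrite ge0_integralZl_EFin//.
  + by rewrite -[leRHS]mule1 lee_wpmul2l// lee_fin invr_ge0 exprn_ge0.
  + by move=> p _; rewrite lee_fin mulr_ge0 ?weight_ge0// exprn_ge0.
- by move=> k p _; rewrite lee_fin mulr_ge0 ?weight_ge0// exprn_ge0.
Qed.

End weight_family.

(** * Weighted L^2 bounds and L^p norms *)

Section weighted_square.
Context d (Y : measurableType d) (R : realType) (mu : {measure set Y -> \bar R}).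

(** With u = v / T and F <= 1, one has F u^2 <= F + u^P: use F where u <= 1 and u^P elsewhere.
    Integration gives the constant 3 = 1 + 2. *)
Lemma le_integral_weighted_square (F v : Y -> R) (P T : R) :
  measurable_fun setT F -> measurable_fun setT v ->
  (forall y, 0 <= F y <= 1) -> (forall y, 0 <= v y) -> 2 <= P -> 0 < T ->
  (\int[mu]_y (F y)%:E <= 1)%E -> (\int[mu]_y (v y `^ P)%:E <= (2 * T `^ P)%:E)%E ->
  (\int[mu]_y (F y * v y ^+ 2)%:E <= (3 * T ^+ 2)%:E)%E.
Proof.
move=> mF mv F01 v0 P2 T0 iF iv.
have TP0 : 0 < T `^ P by exact: powR_gt0.
have mvP : measurable_fun setT (fun y => v y `^ P).
  by apply: (measurableT_comp (measurable_powR P)).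
have c0 : 0 <= T ^+ 2 / T `^ P by rewrite divr_ge0 ?sqr_ge0// ltW.
apply: (@le_trans _ _
  (\int[mu]_y ((T ^+ 2)%:E * (F y)%:E + (T ^+ 2 / T `^ P)%:E * (v y `^ P)%:E))%E).
  apply: ge0_le_integral => //.
  - by move=> y _; rewrite lee_fin mulr_ge0 ?sqr_ge0//; case/andP: (F01 y).
  - by apply/measurable_EFinP/measurable_funM => //; exact: measurable_funX.
  - by apply: emeasurable_funD; apply: measurable_funeM; exact/measurable_EFinP.
  - move=> y _; rewrite -!EFinM -EFinD lee_fin.
    have /andP[F0 F1] := F01 y; have vy0 := v0 y.
    pose u := v y / T; have u0 : 0 <= u by rewrite divr_ge0// ltW.
    have vE : v y = u * T by rewrite /u mulfVK// gt_eqF.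
    rewrite vE (powRM _ u0 (ltW T0)) exprMn.
    rewrite [X in _ <= _ + X](_ : _ = T ^+ 2 * u `^ P); last first.
      by field; rewrite gt_eqF.
    rewrite mulrA mulrC -mulrDr ler_wpM2l ?sqr_ge0//.
    have [u1|/ltW u1] := leP u 1.
      have u21 : u ^+ 2 <= 1 by rewrite expr_le1.
      have : 0 <= u `^ P by exact: powR_ge0.
      have : F y * u ^+ 2 <= F y by rewrite ler_piMr.
      lra.
    have uP : u ^+ 2 <= u `^ P by rewrite -powR_mulrn// ler_powR.
    have : F y * u ^+ 2 <= u ^+ 2 by rewrite ler_piMl// sqr_ge0.
    lra.
rewrite ge0_integralD//; last 4 first.
- by move=> y _; rewrite mule_ge0 ?lee_fin ?sqr_ge0//; case/andP: (F01 y).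
- by apply: measurable_funeM; exact/measurable_EFinP.
- by move=> y _; rewrite mule_ge0 ?lee_fin// powR_ge0.
- by apply: measurable_funeM; exact/measurable_EFinP.
rewrite ge0_integralZl_EFin//; last 3 first.
- by move=> y _; rewrite lee_fin; case/andP: (F01 y).
- exact/measurable_EFinP.
- exact: sqr_ge0.
rewrite ge0_integralZl_EFin//; last 2 first.
- by move=> y _; rewrite lee_fin powR_ge0.
- exact/measurable_EFinP.
rewrite (_ : 3 * T ^+ 2 = T ^+ 2 * 1 + (T ^+ 2 / T `^ P) * (2 * T `^ P)); last first.
  by field; rewrite gt_eqF.
rewrite EFinD !EFinM leeD//.
  by rewrite lee_wpmul2l// lee_fin sqr_ge0.
by rewrite -EFinM lee_wpmul2l// lee_fin.
Qed.

Lemma le_integral_scale (f1 f2 : Y -> R) (c : R) : 0 <= c ->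
  measurable_fun setT f1 -> measurable_fun setT f2 ->
  (forall y, 0 <= f1 y) -> (forall y, 0 <= f2 y) ->
  (forall y, f1 y <= c * f2 y) ->
  (\int[mu]_y (f1 y)%:E <= c%:E * \int[mu]_y (f2 y)%:E)%E.
Proof.
move=> c0 mf1 mf2 f10 f20 f12; rewrite -ge0_integralZl_EFin//; last 2 first.
- by move=> y _; rewrite lee_fin.
- exact/measurable_EFinP.
apply: ge0_le_integral => //.
- by move=> y _; rewrite lee_fin.
- exact/measurable_EFinP.
- by apply: measurable_funeM; exact/measurable_EFinP.
- by move=> y _; rewrite -EFinM lee_fin.
Qed.

Lemma integral_powR_Lnorm (v : Y -> R) (P : R) : P != 0 -> (forall y, 0 <= v y) ->
  (\int[mu]_y (v y `^ P)%:E = 'N[mu]_(P%:E) [EFin \o v] `^ P)%E.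
Proof.
move=> P0 v0; rewrite (poweR_Lnorm _ _ P0); apply: eq_integral => y _.
by rewrite gee0_abs ?lee_fin// poweR_EFin.
Qed.

Lemma Lnorm_powR_inv (v : Y -> R) (P I : R) : (forall y, 0 <= v y) ->
  (\int[mu]_y (v y `^ P)%:E = I%:E)%E ->
  ('N[mu]_(P%:E) [EFin \o v] = (I `^ P^-1)%:E)%E.
Proof.
move=> v0 vI; rewrite unlock.
have -> : (\int[mu]_y `|(EFin \o v) y| `^ P = I%:E)%E; last by rewrite poweR_EFin.
by rewrite -vI; apply: eq_integral => y _; rewrite gee0_abs ?lee_fin// poweR_EFin.
Qed.

End weighted_square.

(** * Transfer of lower bounds for the Yamabe energy *)

Section transfer.
Context {R : realType} {n : nat} (M : smooth_manifold R n).
Implicit Types (g h : metric M) (p : M) (u v : M -> R).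
Local Notation mu := (@riemannian_measure R n M).
Local Notation bM := (@borel R n M).
Local Notation P := (@yamabe_exponent R n).
Hypothesis n3 : (3 <= n)%N.

Lemma yamabe_exponent_ge2 : 2 <= P.
Proof.
have n3R : 3 <= n%:R :> R by rewrite (ler_nat _ 3).
by rewrite /yamabe_exponent ler_pdivlMr; lra.
Qed.

Definition energy g v : R := \int[mu g]_p energy_density g v p.

Lemma yamabe_energyE g v : yamabe_energy g v =
  energy g v / fine ('N[mu g]_(P%:E) [EFin \o (v : bM -> R)]) ^+ 2.
Proof. by []. Qed.

(** If -K bounds the energies of g1 from below, then energy g2 v >= - K n1^2 - C n2^2 for the norms
    n1 of w and n2 of v. As K >= 0 and n1 <= 2 n2, the constant 4 K + C results. *)
Lemma yamabe_transfer g1 g2 (C : R) : 0 <= C ->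
  (forall f : bM -> R, measurable_fun setT f -> (forall p, 0 <= f p) ->
    (\int[mu g1]_p (f p)%:E <= 2%:E * \int[mu g2]_p (f p)%:E)%E /\
    (\int[mu g2]_p (f p)%:E <= 2%:E * \int[mu g1]_p (f p)%:E)%E) ->
  (forall v, test_function v -> exists w : M -> R,
    [/\ test_function w, forall p, v p / 2 <= w p <= v p &
     forall T, 0 < T -> (\int[mu g2]_p (v p `^ P)%:E <= (T `^ P)%:E)%E ->
       energy g1 w <= energy g2 v + C * T ^+ 2]) ->
  yamabe_constant g1 <> -oo%E -> yamabe_constant g2 <> -oo%E.
Proof.
move=> C0 N12 H Y1.
have P2 := yamabe_exponent_ge2; have P0 : 0 < P by exact: lt_le_trans P2.
have Pn0 : P != 0 by rewrite gt_eqF.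
have [K K0 KP] : exists2 K, 0 <= K & forall w, test_function w -> - K <= yamabe_energy g1 w.
  have lbd w : test_function w -> (yamabe_constant g1 <= (yamabe_energy g1 w)%:E)%E.
    by move=> tw; apply: ereal_inf_lbound; exists w.
  move: Y1 lbd; case: (yamabe_constant g1) => [r _ lbd|_ lbd|//].
    exists `|r| => // w /lbd; rewrite lee_fin; apply: le_trans.
    by rewrite lerNl -normrN ler_norm.
  by exists 0 => // w /lbd; rewrite leye_eq.
suff : ((- (4 * K + C))%:E <= yamabe_constant g2)%E.
  by move=> + Y2; rewrite Y2 leeNy_eq.
apply: le_ereal_inf_tmp => _ [v tv <-]; rewrite lee_fin yamabe_energyE.
have [w [tw vw wQ]] := H v tv.
have [[bv _] [bw _]] := (proj1 (test_functionP v) tv, proj1 (test_functionP w) tw).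
have [sv v0 _] := bv; have [sw w0 _] := bw.
have mv : measurable_fun setT (v : bM -> R).
  by apply: cellwise_measurable; exact: cellwise_smooth.
have mw : measurable_fun setT (w : bM -> R).
  by apply: cellwise_measurable; exact: cellwise_smooth.
have mvP : measurable_fun setT (fun p : bM => v p `^ P).
  by apply: (measurableT_comp (measurable_powR P)).
have mwP : measurable_fun setT (fun p : bM => w p `^ P).
  by apply: (measurableT_comp (measurable_powR P)).
have := @integral_powR_Lnorm _ bM R (mu g2) v P Pn0 v0.
have := Lnorm_ge0 (mu g2) P%:E (EFin \o (v : bM -> R)).
(* An infinite norm becomes 0 under [fine], and division by 0 gives 0. Infinite and zero norms thus
   have energy 0, above the nonpositive bound. *)
case: ('N[_]_(_) [_])%E => [n2|_ _|//]; last first.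
  by rewrite /= expr0n/= invr0 mulr0 oppr_le0 addr_ge0// mulr_ge0.
rewrite lee_fin /= le_eqVlt => /predU1P[<- _|n20].
  by rewrite expr0n/= invr0 mulr0 oppr_le0 addr_ge0// mulr_ge0.
move=> iv.
have n2P : 0 < n2 `^ P by exact: powR_gt0.
have wv : (\int[mu g2]_p (w p `^ P)%:E <= \int[mu g2]_p (v p `^ P)%:E)%E.
  apply: ge0_le_integral => //.
  - by move=> p _; rewrite lee_fin powR_ge0.
  - exact/measurable_EFinP.
  - exact/measurable_EFinP.
  - move=> p _; rewrite lee_fin ge0_ler_powR ?nnegrE ?(ltW P0)//.
    by have /andP[] := vw p.
have [Nw1 Nw2] := N12 _ mwP (fun p => powR_ge0 _ _).
have iw_le : (\int[mu g1]_p (w p `^ P)%:E <= (2 * n2 `^ P)%:E)%E.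
  apply: le_trans Nw1 _; rewrite EFinM lee_wpmul2l// ?lee_fin//.
  by rewrite -iv.
have iw_ge0 : (0 <= \int[mu g1]_p (w p `^ P)%:E)%E.
  by apply: integral_ge0 => p _; rewrite lee_fin powR_ge0.
have [i1 i1E] : exists i1, (\int[mu g1]_p (w p `^ P)%:E = i1%:E)%E.
  exists (fine (\int[mu g1]_p (w p `^ P)%:E)%E).
  by rewrite fineK// ge0_fin_numE// (le_lt_trans iw_le)// ltry.
have i1_le : i1 <= 2 * n2 `^ P.
  rewrite -lee_fin; exact: (eq_ind _ (fun z => (z <= _)%E) iw_le _ i1E).
have i1_ge0 : 0 <= i1.
  rewrite -lee_fin; exact: (eq_ind _ (fun z => (0 <= z)%E) iw_ge0 _ i1E).
have Nw3 := eq_ind _ (fun z => (_ <= 2%:E * z)%E) Nw2 _ i1E.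
(* If the norm of w were 0, its quotient would be 0 by convention and [KP] would say nothing about
   [energy g1 w]. Since v <= 2 w, the norm of v would vanish as well. *)
have i10 : 0 < i1.
  rewrite lt_neqAle i1_ge0 andbT; apply/eqP => i10.
  have : (\int[mu g2]_p (v p `^ P)%:E <= (2 `^ P)%:E * \int[mu g2]_p (w p `^ P)%:E)%E.
    apply: (@le_integral_scale _ bM R (mu g2) _ _ (2 `^ P) (powR_ge0 _ _) mvP mwP).
    - by move=> p; exact: powR_ge0.
    - by move=> p; exact: powR_ge0.
    - move=> p; rewrite -powRM//; apply: ge0_ler_powR.
      + exact: ltW.
      + by rewrite nnegrE.
      + by rewrite nnegrE mulr_ge0.
      + by have /andP[+ _] := vw p; rewrite ler_pdivrMr// mulrC.
  apply/negP; rewrite -ltNge iv.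
  apply: (@le_lt_trans _ _ ((2 `^ P)%:E * (2 * i1)%:E)%E).
    by rewrite lee_wpmul2l// lee_fin powR_ge0.
  by rewrite -i10 mulr0 mule0 lte_fin.
have N1 := @Lnorm_powR_inv _ bM R (mu g1) w P i1 w0 i1E.
pose n1 := i1 `^ P^-1.
have n10 : 0 < n1 by exact: powR_gt0.
(* The factor 2 between the volumes is at most 2^P, as P >= 1. *)
have n1_le : n1 <= 2 * n2.
  have n2_ge0 := ltW n20; have n22 : 0 <= 2 * n2 by rewrite mulr_ge0.
  rewrite (_ : 2 * n2 = ((2 * n2) `^ P) `^ P^-1); last by rewrite -powRrM mulfV// powRr1.
  apply: ge0_ler_powR; rewrite ?nnegrE ?invr_ge0 ?powR_ge0 ?(ltW P0)//.
  rewrite powRM//; apply: le_trans i1_le _; rewrite ler_wpM2r ?(ltW n2P)//.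
  rewrite -[leLHS]powRr1// ler_powR ?ler1n//.
  by apply: le_trans P2; rewrite ler1n.
have Q1 : - K * n1 ^+ 2 <= energy g1 w.
  by have := KP w tw; rewrite yamabe_energyE N1/= ler_pdivlMr// exprn_gt0.
have Q2 : energy g1 w <= energy g2 v + C * n2 ^+ 2 by apply: wQ => //; rewrite iv.
have n12 : n1 ^+ 2 <= 4 * n2 ^+ 2.
  have -> : 4 * n2 ^+ 2 = (2 * n2) ^+ 2 by ring.
  by rewrite ler_sqr ?nnegrE ?mulr_ge0// ltW.
have Kn : K * n1 ^+ 2 <= K * (4 * n2 ^+ 2) by exact: ler_wpM2l.
move: Q1 Q2 Kn; move: (energy g1 w) (energy g2 v) (n1 ^+ 2) => E1 E2 N.
move: (n2 ^+ 2) (exprn_gt0 2 n20) => a a0 Q1 Q2 Kn.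
rewrite ler_pdivlMr//; move: Q1 Q2 Kn; clear; lra.
Qed.

End transfer.

(** * Comparison of Yamabe constants near a metric *)

Section neighborhood.
Context {R : realType} {n : nat} (M : smooth_manifold R n).
Implicit Types (g h : metric M) (p : M) (u v : M -> R).
Local Notation mu := (@riemannian_measure R n M).
Local Notation bM := (@borel R n M).
Local Notation P := (@yamabe_exponent R n).
Hypothesis n3 : (3 <= n)%N.

Definition close_metrics g h p (e : R) : Prop :=
  [/\ `|ratio g h p - 1| <= e,
      forall u : 'rV[R]_n, `|ratio g h p * qf (invmx (h (chart_at p) p)) u
        - qf (invmx (g (chart_at p) p)) u| <= e * qf (invmx (g (chart_at p) p)) u &
      `|ratio g h p * scal h p - scal g p| <= e].

Lemma close_metrics_nbhd g (e : nat -> R) : (forall k, 0 < e k) ->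
  exists U : set (jet2 M), [/\ open U, graph_j2 g `<=` U &
    forall h, graph_j2 h `<=` U -> forall k p, cell k p -> close_metrics g h p (e k)].
Proof.
move=> e0; have [U [oU gU UP]] := fine_nbhd g e0.
exists U; split=> // h hU k p kp; have ip := chart_at_img p.
have := UP h hU k p kp; rewrite -(chart_atE kp).
move=> /(jet_gapP (loc_posdef g ip) (loc_posdef h ip)).
by rewrite /close_metrics !scal_jetE /loc parK//; exact: chart_atP.
Qed.

Section comparison.
Variables (g h : metric M) (c : nat -> R).
Hypothesis c0 : forall k, 0 < c k.
Hypothesis cP : forall K : set M, compact K -> exists zeta F : M -> R,
    [/\ bump_function zeta /\ (forall p, zeta p <= 2^-1),
        (forall p k, K p -> cell k p -> c k <= zeta p), cellwise F,
        (forall p, weight g zeta p <= F p <= 1) & (\int[mu g]_p (F p)%:E <= 1)%E].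
(** The bound 1/2 keeps the ratio of the densities in [1/2, 2]. The bound [c k ^+ 2 / 2] is at most
    zeta^2 / 2 on the part of the cell in K, which is the share of the gradient that damping
    frees. *)
Hypothesis close : forall k p, cell k p ->
  close_metrics g h p (Num.min 2^-1 (c k ^+ 2 / 2)).

Local Notation r := (ratio g h).

Let r_bounds p : 2^-1 <= r p <= 2.
Proof.
have [k kp] := ex_cell p; have [+ _ _] := close kp.
rewrite le_min => /andP[+ _]; rewrite ler_norml; lra.
Qed.

Let integral_bounds (f : bM -> R) : measurable_fun setT f -> (forall p, 0 <= f p) ->
  (\int[mu h]_p (f p)%:E <= 2%:E * \int[mu g]_p (f p)%:E)%E /\
  (\int[mu g]_p (f p)%:E <= 2%:E * \int[mu h]_p (f p)%:E)%E.
Proof.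
move=> mf f0; have mr : measurable_fun setT (r : bM -> R).
  by apply: cellwise_measurable; exact: cellwise_ratio.
have mfr : measurable_fun setT (fun p : bM => f p * r p) by exact: measurable_funM.
have r0 p : 0 <= r p by exact: ratio_ge0.
have fr0 p : 0 <= f p * r p by exact: mulr_ge0.
have gh := integral_ratio g h mf.
have ab (a b : R) : 0 <= a -> 2^-1 <= b <= 2 -> a * b <= 2 * a /\ a <= 2 * (a * b).
  by move=> a0 /andP[b1 b2]; nra.
have le1 : (\int[mu g]_p (f p * r p)%:E <= 2%:E * \int[mu g]_p (f p)%:E)%E.
  apply: (@le_integral_scale _ bM R (mu g) _ _ 2 (ler0n R 2) mfr mf fr0 f0) => p.
  exact: proj1 (ab _ _ (f0 p) (r_bounds p)).
have le2 : (\int[mu g]_p (f p)%:E <= 2%:E * \int[mu g]_p (f p * r p)%:E)%E.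
  apply: (@le_integral_scale _ bM R (mu g) _ _ 2 (ler0n R 2) mf mfr f0 fr0) => p.
  exact: proj2 (ab _ _ (f0 p) (r_bounds p)).
split; first exact: (eq_ind_r (fun z => (z <= _)%E) le1 gh).
exact: (eq_ind_r (fun z => (_ <= 2%:E * z)%E) le2 gh).
Qed.

(** One w serves both directions. The factor 2 before T^P leaves room for a norm of v taken in h
    instead of g. *)
Let damped v : test_function v -> exists w, [/\ test_function w,
  forall p, v p / 2 <= w p <= v p &
  forall T, 0 < T -> (\int[mu g]_p (v p `^ P)%:E <= (2 * T `^ P)%:E)%E ->
    energy h w <= energy g v + 3 * T ^+ 2 /\
    energy g w <= energy h v + 3 * T ^+ 2].
Proof.
move=> /test_functionP[bv [p1 vp1]]; have [sv v0 [K cK vK]] := bv.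
have [zeta [F [[bz z2] zc cF WF iF]]] := cP cK.
have [sz z0 _] := bz.
have clK := compact_closed_manifold cK.
pose w p := (1 - zeta p ^+ 2) * v p.
have phi p : 2^-1 <= 1 - zeta p ^+ 2 <= 1.
  by have := z0 p; have := z2 p; rewrite expr2; nra.
have sphi : smooth (fun p => 1 - zeta p ^+ 2).
  have -> : (fun p => 1 - zeta p ^+ 2) = fun p => 1 + -1 * (zeta p * zeta p).
    by apply/funext => p; rewrite mulN1r expr2.
  apply: smooth_add; first exact: smooth_cst.
  by apply: smooth_mul; [exact: smooth_cst|exact: smooth_mul].
have bw : bump_function w.
  by apply: bump_mul => // p; have := phi p; lra.
have [sw w0 _] := bw.
have wK p : ~ K p -> w p = 0 by move=> nK; rewrite /w vK ?mulr0.
exists w; split.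
- apply/test_functionP; split=> //; exists p1; rewrite mulf_neq0//.
  by rewrite gt_eqF//; have := phi p1; lra.
- move=> p; have := phi p; have := v0 p; rewrite /w => vp /andP[h1 h2].
  by rewrite mulrC ler_wpM2r//= ler_piMl.
move=> T T0 iv.
have mF : measurable_fun setT (F : bM -> R) by exact: cellwise_measurable.
have mv : measurable_fun setT (v : bM -> R).
  by apply: cellwise_measurable; exact: cellwise_smooth.
have F01 p : 0 <= F p <= 1.
  by have /andP[WFp ->] := WF p; rewrite (le_trans (weight_ge0 n3 g zeta p) WFp).
have cFv : cellwise (fun p => F p * v p ^+ 2).
  by apply: cellwise_mul => //; apply: cellwise_sqr; exact: cellwise_smooth.
have FvK p : ~ K p -> F p * v p ^+ 2 = 0 by move=> nK; rewrite vK// expr0n mulr0.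
have iFv := integrable_compact_support g cK cFv FvK.
have Fv_le : \int[mu g]_p (F p * v p ^+ 2) <= 3 * T ^+ 2.
  have := @le_integral_weighted_square _ bM R (mu g) F v P T mF mv F01 v0
    (yamabe_exponent_ge2 n3) T0 iF iv.
  by rewrite -(fineK (integrable_fin_num measurableT iFv)) lee_fin.
have pointwise p : r p * energy_density h w p <= energy_density g v p + F p * v p ^+ 2 /\
    energy_density g w p <= r p * energy_density h v p + F p * v p ^+ 2.
  have [Kp|nK] := pselect (K p); last first.
    rewrite !(energy_density_out _ clK vK nK) !(energy_density_out _ clK wK nK).
    by rewrite FvK// !mulr0 addr0.
  have [k kp] := ex_cell p; have [e1 e2 e3] := close kp.
  have ck := zc p k Kp kp; have ck0 := c0 k.
  have zp : 0 < zeta p <= 2^-1 by rewrite z2 (lt_le_trans ck0 ck).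
  have ez : Num.min 2^-1 (c k ^+ 2 / 2) <= zeta p ^+ 2 / 2.
    rewrite ge_min; apply/orP; right; rewrite ler_pM2r ?invr_gt0//.
    by rewrite ler_sqr ?nnegrE ?z0// ltW.
  have /andP[WFp _] := WF p.
  have Wv : weight g zeta p * v p ^+ 2 <= F p * v p ^+ 2.
    by rewrite ler_wpM2r ?sqr_ge0.
  split.
    apply: le_trans (energy_density_damped_compare_l n3 e1 e2 e3 sz sv zp ez) _.
    by rewrite lerD2l.
  apply: le_trans (energy_density_damped_compare_r n3 e1 e2 e3 sz sv zp ez) _.
  by rewrite lerD2l.
have energy_h u : smooth u -> energy h u = \int[mu g]_p (r p * energy_density h u p).
  move=> su; have mu_ : measurable_fun setT (energy_density h u : bM -> R).
    by apply: cellwise_measurable; exact: cellwise_energy_density.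
  rewrite /energy /Rintegral; apply: (congr1 fine).
  apply: (etrans (integral_ratio g h mu_)).
  by apply: eq_integral => p _; rewrite mulrC.
have ih u : smooth u -> (forall p, ~ K p -> u p = 0) ->
    (mu g).-integrable setT (EFin \o ((fun p => r p * energy_density h u p) : bM -> R)).
  move=> su uK; apply: (integrable_compact_support g cK).
    by apply: cellwise_mul; [exact: cellwise_ratio|exact: cellwise_energy_density].
  by move=> p nK; rewrite (energy_density_out _ clK uK nK) mulr0.
have ig u : smooth u -> (forall p, ~ K p -> u p = 0) ->
    (mu g).-integrable setT (EFin \o (energy_density g u : bM -> R)).
  move=> su uK; apply: (integrable_compact_support g cK).
    exact: cellwise_energy_density.
  by move=> p nK; exact: energy_density_out clK uK nK.
split.
  rewrite energy_h//; apply: (@le_trans _ _ (\int[mu g]_p (energy_density g v p + F p * v p ^+ 2))).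
    apply: le_Rintegral => //.
    - exact: ih.
    - by apply: (integrableD measurableT (ig v sv vK) iFv).
    - by move=> p _; have [] := pointwise p.
  by rewrite RintegralD//; [rewrite lerD2l|exact: ig].
rewrite energy_h//; apply: (@le_trans _ _
  (\int[mu g]_p (r p * energy_density h v p + F p * v p ^+ 2))).
  apply: le_Rintegral => //.
  - exact: ig.
  - by apply: (integrableD measurableT (ih v sv vK) iFv).
  - by move=> p _; have [] := pointwise p.
by rewrite RintegralD//; [rewrite lerD2l|exact: ih].
Qed.

Lemma yamabe_close_metrics : yamabe_constant h = -oo%E <-> yamabe_constant g = -oo%E.
Proof.
have TP2 (T : R) : 0 < T -> ((T `^ P)%:E <= (2 * T `^ P)%:E)%E.
  by move=> T0; rewrite lee_fin ler_peMl ?powR_ge0// ler1n.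
split; apply: contraPP.
  apply: (yamabe_transfer n3 (ler0n R 3)).
    by move=> f mf f0; have [] := integral_bounds mf f0.
  (* The norm of v is now bounded in h, and passing to g uses up the factor 2 in [damped]. *)
  move=> v tv; have [w [tw vw wQ]] := damped tv; exists w; split=> // T T0 iv.
  apply: (fun iv' => proj2 (wQ T T0 iv')).
  have [sv v0 _] := (proj1 (proj1 (test_functionP v) tv)).
  have mvP : measurable_fun setT (fun p : bM => v p `^ P).
    apply: (measurableT_comp (measurable_powR P)).
    by apply: cellwise_measurable; exact: cellwise_smooth.
  have [_ /le_trans] := integral_bounds mvP (fun p => powR_ge0 _ _); apply.
  by rewrite EFinM lee_wpmul2l// lee_fin.
apply: (yamabe_transfer n3 (ler0n R 3)); first exact: @integral_bounds.
move=> v tv; have [w [tw vw wQ]] := damped tv; exists w; split=> // T T0 iv.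
exact: proj1 (wQ T T0 (le_trans iv (TP2 T T0))).
Qed.

End comparison.

Lemma yamabe_locally_constant g : exists U : set (jet2 M),
  [/\ open U, graph_j2 g `<=` U & forall h, graph_j2 h `<=` U ->
    (yamabe_constant h = -oo%E <-> yamabe_constant g = -oo%E)].
Proof.
have [c [c0 cP]] := weight_family n3 g.
have e0 k : 0 < Num.min 2^-1 (c k ^+ 2 / 2) by rewrite lt_min invr_gt0 ltr0n/= divr_gt0// exprn_gt0.
have [U [oU gU UP]] := close_metrics_nbhd g e0.
exists U; split; [exact: oU|exact: gU|move=> h hU].
exact: (yamabe_close_metrics c0 cP (UP h hU)).
Qed.

End neighborhood.

Theorem theorem1p5 (R : realType) (n : nat) (M : smooth_manifold R n)
    (hn : (3 <= n)%N) :
  open [set g : fine_C2 M | yamabe_constant g = -oo%E] /\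
  closed [set g : fine_C2 M | yamabe_constant g = -oo%E].
Proof.
split.
  move=> g /= Yg; have [U [oU gU UP]] := yamabe_locally_constant hn g.
  by exists U; split; [exact: oU|exact: gU|move=> h hU; apply/(UP h hU)].
suff : fine_C2_open (~` [set g : fine_C2 M | yamabe_constant g = -oo%E]).
  by rewrite -openC.
move=> g /= Yg; have [U [oU gU UP]] := yamabe_locally_constant hn g.
by exists U; split; [exact: oU|exact: gU|move=> h hU /(UP h hU)].
Qed.
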